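(* Let $M$ be a strongly regular sequence, $\Omega\subset\mathbb{R}^n$ open, let $\varphi$ be a non-zero element of $\mathcal{C}_M(\Omega)$, let $X$ be its zero set and $X_\infty=\{a\in X: T_a\varphi=0\}$ its set of points of flatness. Put $\mathcal{I}=\varphi\,\mathcal{C}_M(\Omega)$. The following are equivalent: (A') $\varphi$ satisfies the $\mathcal{C}_M$ Łojasiewicz condition; (B') $\underline{m}^\infty_{X,M}\subset\mathcal{I}$ and $X\setminus X_\infty$ is dense in $\partial X$; (C') $\underline{m}^\infty_{X,M}=\mathcal{I}\,\underline{m}^\infty_{X,M}$.
   Context: Multi-index notation: $J=(j_1,\dots,j_n)$, $j=j_1+\dots+j_n$, $J!=j_1!\cdots j_n!$, $D^J=\partial^j/\partial x_1^{j_1}\cdots\partial x_n^{j_n}$. $T_a\varphi=\sum_J\frac{1}{J!}D^J\varphi(a)x^J$ is the formal Taylor series at $a$; a function is flat at $a$ if its Taylor series at $a$ is $0$. A sequence $M=(M_j)_{j\ge0}$ of reals is strongly regular if: $M$ is increasing with $M_0=1$; $M_{j+1}/M_j$ is increasing; there is $A>0$ with $M_{j+k}\le A^{j+k}M_jM_k$ for all $j,k$; and there is $A>0$ with $\sum_{j\ge k}\frac{M_j}{(j+1)M_{j+1}}\le A\frac{M_k}{M_{k+1}}$ for all $k$. $h_M(t)=\inf_{j\ge0}t^jM_j$ for $t>0$, $h_M(0)=0$. $\mathcal{C}_M(\Omega)$ is the algebra of $f\in\mathcal{C}^\infty(\Omega)$ such that for every compact $K\subset\Omega$ there are $C,\sigma>0$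 with $\vert D^Jf(x)\vert\le C\sigma^j j!M_j$ for all $J$, $x\in K$. $\underline{m}^\infty_{X,M}$ denotes the ideal of elements of $\mathcal{C}_M(\Omega)$ flat at every point of $X$, and $\mathcal{I}\,\underline{m}^\infty_{X,M}$ is the product ideal (here equal to $\{\varphi g: g\in\underline{m}^\infty_{X,M}\}$). A non-zero $\varphi\in\mathcal{C}_M(\Omega)$ with zero set $X$ satisfies the $\mathcal{C}_M$ Łojasiewicz condition if for every compact $K\subset\Omega$ and every real $\lambda>0$ there exist $C,\sigma>0$ such that for all $J\in\mathbb{N}^n$ and all $x\in K\setminus X$, $\vert D^J(1/\varphi)(x)\vert\le \dfrac{C\sigma^j j!M_j}{h_M(\lambda\,\mathrm{dist}(x,X))}$. *)

(* Defs.v *)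
From HB Require Import structures.
From mathcomp Require Import all_boot all_order all_algebra.
From mathcomp Require Import all_classical all_reals all_analysis.
Set Implicit Arguments. Unset Strict Implicit. Unset Printing Implicit Defensive.
Import Order.TTheory GRing.Theory Num.Theory.
Import numFieldNormedType.Exports.
Local Open Scope classical_set_scope.
Local Open Scope ring_scope.

Section SeqDefs.
Context {R : realType}.

(* Strongly regular sequence (the series condition is stated via its
   partial sums, which is the meaning of "sum of a non-negative series <= bound"). *)
Definition strongly_regular (M : nat -> R) : Prop :=
  [/\ M 0%N = 1,
      (forall j, M j <= M j.+1),
      (forall j, M j.+1 / M j <= M j.+2 / M j.+1),
      (exists2 A : R, 0 < A & forall j k, M (j + k)%N <= A ^+ (j + k) * M j * M k) &
      (exists2 A : R, 0 < A & forall k N,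
          \sum_(k <= j < N) M j / ((j.+1)%:R * M j.+1) <= A * (M k / M k.+1))].

Definition hM (M : nat -> R) (t : R) : R :=
  if t == 0 then 0 else inf (range (fun j : nat => t ^+ j * M j)).

(* h_M extended to [0,+oo]: h_M(+oo) = inf_j (+oo)^j M_j = M_0 (used when the
   distance to an empty set is +oo). *)
Definition hMbar (M : nat -> R) (t : \bar R) : R :=
  match t with
  | EFin r => hM M r
  | EPInf => M 0%N
  | ENInf => 0
  end.
End SeqDefs.

Section Defs.
Context {R : realType} {n : nat}.
Local Notation V := 'rV[R]_n.

Definition evec (i : 'I_n) : V := delta_mx 0 i.

Definition pderiv (i : 'I_n) (f : V -> R) : V -> R := fun x => 'D_(evec i) f x.

Definition Dmi (J : 'I_n -> nat) (f : V -> R) : V -> R :=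
  foldr (fun i g => iter (J i) (pderiv i) g) f (enum 'I_n).

Definition mdeg (J : 'I_n -> nat) : nat := \sum_(i < n) J i.

Definition iter_pderiv (s : seq 'I_n) (f : V -> R) : V -> R := foldr pderiv f s.

Definition smooth_on (O : set V) (f : V -> R) : Prop :=
  forall (s : seq 'I_n) (x : V), O x ->
    {for x, continuous (iter_pderiv s f)} /\
    (forall i, derivable (iter_pderiv s f) x (evec i)).

Definition inCM (M : nat -> R) (O : set V) (f : V -> R) : Prop :=
  smooth_on O f /\
  forall K : set V, compact K -> K `<=` O ->
    exists C sig : R, [/\ 0 < C, 0 < sig &
      forall (J : 'I_n -> nat) (x : V), K x ->
        `|Dmi J f x| <= C * sig ^+ mdeg J * (mdeg J)`!%:R * M (mdeg J)].

Definition flat_at (f : V -> R) (a : V) : Prop := forall J : 'I_n -> nat, Dmi J f a = 0.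

Definition zeroset (O : set V) (phi : V -> R) : set V := [set x | O x /\ phi x = 0].

(* Euclidean norm and Euclidean distance to a set (+oo for the empty set) *)
Definition eucl (x : V) : R := Num.sqrt (\sum_(i < n) x ord0 i ^+ 2).
Definition dist_set (X : set V) (x : V) : \bar R :=
  ereal_inf [set (eucl (x - y))%:E | y in X].

Definition flat_ideal (M : nat -> R) (O : set V) (X : set V) : set (V -> R) :=
  [set g | inCM M O g /\ forall a, X a -> flat_at g a].

(* the principal ideal phi C_M(O) (elements identified when equal on O) *)
Definition princ_ideal (M : nat -> R) (O : set V) (phi : V -> R) : set (V -> R) :=
  [set f | inCM M O f /\ exists2 h, inCM M O h & forall x, O x -> f x = phi x * h x].

(* the product ideal (phi C_M(O)) m^infty_{X,M} = { phi g : g in m^infty_{X,M} } *)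
Definition prod_ideal (M : nat -> R) (O : set V) (phi : V -> R) (X : set V) : set (V -> R) :=
  [set f | inCM M O f /\ exists2 g, flat_ideal M O X g & forall x, O x -> f x = phi x * g x].

Definition CM_lojasiewicz (M : nat -> R) (O : set V) (phi : V -> R) : Prop :=
  let X := zeroset O phi in
  forall K : set V, compact K -> K `<=` O -> forall lam : R, 0 < lam ->
    exists C sig : R, [/\ 0 < C, 0 < sig &
      forall (J : 'I_n -> nat) (x : V), K x -> ~ X x ->
        `|Dmi J (fun y => (phi y)^-1) x| <=
          C * sig ^+ mdeg J * (mdeg J)`!%:R * M (mdeg J)
          / hMbar M (lam%:E * dist_set X x)%E].
End Defs.

(* Main.v *)
(* The quantitative core is the comparison of a function f of the class, flat on
   X, with 1/phi.  Taylor's formula at a nearly closest point of X gives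
   |D^J f(x)| <= C s^j j! M_j h_M(c d), with d = dist (x, X); the Lojasiewicz
   condition for lambda = A c, the Leibniz rule and h_M(c d) <= h_M(A c d)^2
   then bound the derivatives of f/phi by C s^j j! M_j h_M(A c d), which is
   O(d^2).  So f/phi extends by zero to a flat function of the class, and f = phi
   itself cannot be flat on a neighbourhood of a boundary point of X.

   Conversely, divisibility of flat functions by phi already implies the
   Lojasiewicz condition.  If the latter fails near a point of X, it fails along
   a sequence x_p with fast decreasing distances d_p to X.  Take bumps chi_p of
   radius about d_p / (2 (n + 1)), equal to 1 near x_p and with derivatives
   bounded by s^j j! M_j / h_M(lambda d_p); their existence is where strong
   regularity is used.  Then sum_p 2^-(p+1) h_M(lambda d_p) chi_p is a flat
   function of the class, constant to infinite order at x_p, and its quotient by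
   phi has derivatives at x_p too large for the class. *)

Require Import Defs.
From HB Require Import structures.
From mathcomp Require Import all_boot all_order all_algebra.
From mathcomp Require Import all_classical all_reals all_analysis.
From mathcomp Require Import ring lra zify.
Import Order.TTheory GRing.Theory Num.Theory.
Import numFieldNormedType.Exports.
Local Open Scope classical_set_scope.
Local Open Scope ring_scope.
Set Implicit Arguments.
Unset Strict Implicit.
Unset Printing Implicit Defensive.

(** * Weight sequences *)

(** One quotient by [phi] must contradict every pair of constants at once. So the p-th point is
    chosen to violate the Lojasiewicz condition with both constants equal to 2^(p+1) (p+1): the
    power of two pays for the weight of the p-th bump, and p+1 eventually exceeds the constants of
    whatever quotient divisibility provides. Since the flat function has the jet of a constant at
    that point, the jet of its quotient there is a multiple of the jet of 1/phi. The obstacle is a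
    bump whose constant s does not depend on its radius r. A smooth step is taken to be the
    distribution function of an infinite sum of independent uniform variables of widths a_i. Its
    j-th derivative is at most the product of the first j numbers 2/a_i, so only a problem about
    sequences with sum at most r remains. A bump in n variables is a product of 2n steps and would
    cost the power 2n of 1/h_M; moderate growth absorbs this power into the argument of h_M. No
    integral occurs: averaging over an interval is a difference quotient of a primitive, and
    derivatives pass to limits through second-order Taylor bounds uniform in the index. *)

(** The falling factorial [(k + j) ^_ j] lies in between, being a factorial times a binomial
    coefficient. This converts the powers of [k] produced by [k] equal widths. *)
Lemma expn_le_fact_exp2 j k : (k ^ j <= j`! * 2 ^ (k + j))%N.
Proof.
suff h : (k ^ j <= (k + j) ^_ j)%N.
  apply: leq_trans h _; rewrite -bin_ffact mulnC leq_mul2l; apply/orP; right.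
  rewrite -[2%N]/(1 + 1)%N Pascal (bigD1 (inord j)) //= inordK; last by lia.
  by rewrite !exp1n !muln1 leq_addr.
elim: j => [|j IH]; first by rewrite expn0 addn0 ffactn0.
by rewrite addnS ffactSS expnS leq_mul //; lia.
Qed.

Section WeightSequence.
Context {R : realType} (M : nat -> R).
Hypothesis HM : strongly_regular M.

Let m k := M k.+1 / M k.

Lemma weight0 : M 0 = 1. Proof. by case: HM. Qed.

Lemma weight_ge1 j : 1 <= M j.
Proof.
case: HM => M0 Mi _ _ _; elim: j => [|j IH]; first by rewrite M0.
exact: le_trans IH (Mi j).
Qed.

Lemma weight_gt0 j : 0 < M j.
Proof. exact: lt_le_trans ltr01 (weight_ge1 j). Qed.

Lemma weight_ge0 j : 0 <= M j.
Proof. exact/ltW/weight_gt0. Qed.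

Lemma weight_ratio_gt0 k : 0 < M k.+1 / M k.
Proof. by rewrite divr_gt0 // weight_gt0. Qed.

Lemma weightS k : M k.+1 = (M k.+1 / M k) * M k.
Proof. by rewrite divfK // gt_eqF // weight_gt0. Qed.

Lemma weight_ratio_homo j k : (j <= k)%N -> M j.+1 / M j <= M k.+1 / M k.
Proof.
case: HM => _ _ Mc _ _ /subnK <-; elim: (k - j)%N => //= i IH.
exact: le_trans IH (Mc _).
Qed.

Lemma weight_mul_le j k : M j * M k <= M (j + k)%N.
Proof.
elim: j => [|j IH]; first by rewrite weight0 mul1r.
rewrite addSn weightS [M (_ + _).+1]weightS -mulrA.
apply: ler_pM => //; first exact/ltW/weight_ratio_gt0.
  by rewrite mulr_ge0 // ltW // weight_gt0.
by apply: weight_ratio_homo; rewrite leq_addr.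
Qed.

Lemma weight_moderate_growth : exists2 A : R, 1 <= A &
  forall j k, M (j + k)%N <= A ^+ (j + k) * M j * M k.
Proof.
case: HM => _ _ _ [A A0 HA] _; exists (1 + A); first by lra.
move=> j k; apply: le_trans (HA j k) _.
rewrite !ler_wpM2r ?(ltW (weight_gt0 _)) //.
by rewrite lerXn2r ?nnegrE; lra.
Qed.

(** Bounded ratios would make the series condition at [k = 0] dominate a multiple of the harmonic
    series. *)
Lemma weight_ratio_unbounded (L : R) : exists k, L <= M k.+1 / M k.
Proof.
case: HM => _ _ _ _ [A A0 HA].
apply: contrapT => /forallNP H.
have mL k : m k < L by rewrite ltNge; apply/negP/H.
have L0 : 0 < L by apply: lt_trans (weight_ratio_gt0 0) (mL 0%N).
apply: (@dvg_harmonic R).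
apply: nondecreasing_is_cvgn.
  apply: nondecreasing_series => k _ _; exact: harmonic_ge0.
exists (L * (A * (M 0 / M 1))) => _ [N _ <-].
rewrite -ler_pdivrMl //; apply: le_trans (HA 0%N N).
rewrite /series /= mulr_sumr ler_sum // => i _.
have -> : M i / (i.+1%:R * M i.+1) = (m i)^-1 * i.+1%:R^-1.
  by rewrite /m invf_div invfM mulrA mulrAC.
rewrite ler_pM2r ?invr_gt0 ?ltr0n // lef_pV2 ?posrE ?weight_ratio_gt0 //.
exact/ltW/mL.
Qed.

Lemma hME t : 0 < t -> hM M t = inf (range (fun j : nat => t ^+ j * M j)).
Proof. by move=> t0; rewrite /hM gt_eqF. Qed.

Lemma hM_le t j : 0 <= t -> hM M t <= t ^+ j * M j.
Proof.
rewrite le_eqVlt => /predU1P[<-|t0].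
  by rewrite /hM eqxx mulr_ge0 ?exprn_ge0 // ltW // weight_gt0.
rewrite hME //; apply: ge_inf; last by exists j.
by exists 0 => _ [i _ <-]; rewrite mulr_ge0 ?exprn_ge0 // ltW // weight_gt0.
Qed.

Lemma le_hM t y : 0 < t -> (forall j, y <= t ^+ j * M j) -> y <= hM M t.
Proof.
move=> t0 H; rewrite hME //; apply: lb_le_inf; first by exists (t ^+ 0 * M 0), 0%N.
by move=> _ [j _ <-].
Qed.

(** Once the ratio of consecutive weights reaches 1/t, the terms [t ^+ j * M j] no longer decrease;
    the earlier ones are at least [u ^+ k]. *)
Lemma hM_gt0 t : 0 < t -> 0 < hM M t.
Proof.
move=> t0; have [k Hk] := weight_ratio_unbounded t^-1.
pose u := Num.min 1 t.
have u0 : 0 < u by rewrite /u lt_min ltr01 t0.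
have ut : u <= t by rewrite /u ge_min lexx orbT.
have u1 : u <= 1 by rewrite /u ge_min lexx.
apply: lt_le_trans (exprn_gt0 k u0) _; apply: le_hM => // j.
have [u0' t0'] := (ltW u0, ltW t0).
have base i : (i <= k)%N -> u ^+ k <= t ^+ i * M i.
  move=> ik; rewrite -[leLHS]mulr1; apply: ler_pM; rewrite ?exprn_ge0 ?weight_ge1 //.
  apply: (@le_trans _ _ (u ^+ i)); first by rewrite ler_wiXn2l.
  by rewrite lerXn2r ?nnegrE.
have [/base//|/ltnW /subnK <-] := leqP j k.
elim: (j - k)%N => [|i IH]; first exact: base.
apply: le_trans IH _; rewrite addSn weightS exprSr mulrACA -mulrA -[leLHS]mulr1 mulrA.
have h1 : 1 <= t * (M (i + k).+1 / M (i + k)%N).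
  rewrite -ler_pdivrMl // mulr1; apply: le_trans Hk _.
  by apply: weight_ratio_homo; rewrite leq_addl.
have -> : t ^+ (i + k) * M (i + k)%N * 1 = 1 * (t ^+ (i + k) * M (i + k)%N) by ring.
have -> : t ^+ (i + k) * (M (i + k).+1 / M (i + k)%N) * (t * M (i + k)%N) =
   (t * (M (i + k).+1 / M (i + k)%N)) * (t ^+ (i + k) * M (i + k)%N) by ring.
by rewrite ler_wpM2r // mulr_ge0 ?exprn_ge0 // ltW // weight_gt0.
Qed.

Lemma hM_ge0 t : 0 <= t -> 0 <= hM M t.
Proof.
rewrite le_eqVlt => /predU1P[<-|/hM_gt0/ltW//].
by rewrite /hM eqxx.
Qed.

Lemma hM_le1 t : 0 <= t -> hM M t <= 1.
Proof. by move=> /(hM_le 0); rewrite expr0 weight0 mulr1. Qed.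

Lemma hM_homo s t : 0 <= s -> s <= t -> hM M s <= hM M t.
Proof.
rewrite le_eqVlt => /predU1P[<- t0|s0 st].
  by rewrite {1}/hM eqxx hM_ge0.
have t0 := lt_le_trans s0 st.
apply: (le_hM t0) => j; apply: le_trans (hM_le j (ltW s0)) _.
have [s0' t0'] := (ltW s0, ltW t0).
by rewrite ler_wpM2r ?weight_ge0 // lerXn2r.
Qed.

(** Moderate growth splits the term of index [j + k] at [t] into the terms of indices [j] and [k] at
    [A * t], and the two infima are then taken separately. *)
Lemma hM_le_sqr (A : R) : 1 <= A ->
  (forall j k, M (j + k)%N <= A ^+ (j + k) * M j * M k) ->
  forall t, 0 < t -> hM M t <= hM M (A * t) ^+ 2.
Proof.
move=> A1 HA t t0.
have A0 : 0 < A by lra.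
have At0 : 0 < A * t by rewrite mulr_gt0.
have h0 := hM_gt0 At0.
have term j : 0 < (A * t) ^+ j * M j by rewrite mulr_gt0 ?exprn_gt0 ?weight_gt0.
rewrite expr2 -ler_pdivrMl // mulrC; apply: le_hM => // j.
rewrite ler_pdivrMr // -ler_pdivrMl //; apply: le_hM => // k.
rewrite ler_pdivrMl //; apply: le_trans (hM_le (j + k) (ltW t0)) _.
apply: (@le_trans _ _ (t ^+ (j + k) * (A ^+ (j + k) * M j * M k))).
  by rewrite ler_wpM2l // exprn_ge0 // ltW.
by rewrite le_eqVlt; apply/orP; left; apply/eqP; rewrite exprMn exprMn !exprD; ring.
Qed.

(** Used with [q] the number of one-variable factors of a bump, each of which costs a factor
    1/h_M. *)
Lemma hM_le_exp q : exists2 B : R, 0 < B & forall t, 0 < t -> hM M t <= hM M (B * t) ^+ q.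
Proof.
have [A A1 HA] := weight_moderate_growth.
have A0 : 0 < A by lra.
exists (A ^+ q); first exact: exprn_gt0.
elim: q => [|q IH] t t0; first by rewrite !expr0 hM_le1 // ltW.
have At0 : 0 < A * t by rewrite mulr_gt0.
apply: le_trans (hM_le_sqr A1 HA t0) _.
have At0' := ltW At0.
rewrite expr2 exprS; apply: ler_pM; rewrite ?hM_ge0 //.
  by apply: hM_homo; rewrite // exprSr -mulrA ler_peMl // exprn_ege1.
by apply: le_trans (IH _ At0) _; rewrite exprSr mulrA.
Qed.

(* The first [k] widths are all equal, [k] being the index where the infimum
   defining [hM] is nearly attained; the remaining ones are dictated by [M] and
   their sum is controlled by strong non-quasianalyticity. *)
Lemma adapted_widths (lam : R) : 0 < lam -> exists2 sigma : R, 0 < sigma &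
  forall r, 0 < r -> exists a : nat -> R,
   [/\ forall i, 0 < a i, forall N, \sum_(0 <= i < N) a i <= r &
    forall j, (\prod_(0 <= i < j) (2 / a i)) * hM M (lam * r)
       <= sigma ^+ j * j`!%:R * M j].
Proof.
move=> lam0; case: HM => _ _ _ _ [A A0 HA].
(* The first summand pays for the orders up to [k], the second, equal to [2 * B], for each order
   beyond. *)
pose sg : R := 16 * lam + 8 * A * lam.
have Al0 : 0 < A * lam by rewrite mulr_gt0.
have sg0 : 0 < sg by rewrite /sg; lra.
exists sg => // r r0.
have lr0 : 0 < lam * r by rewrite mulr_gt0.
have exk : exists k, (2 * (lam * r))^-1 <= M k.+1 / M k by apply: weight_ratio_unbounded.
(* Below this index each step at least halves [(lam * r) ^+ j * M j]; at this index [M k / M k.+1]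
   is at most [2 * (lam * r)], which bounds the tail of the series. *)
pose k := ex_minn exk.
have [kP kmin] : (2 * (lam * r))^-1 <= m k /\
    forall i, (i < k)%N -> m i < (2 * (lam * r))^-1.
  rewrite /k; case: ex_minnP => k' H1 H2; split=> // i ik.
  by rewrite ltNge; apply/negP => /H2; rewrite leqNgt ik.
(* With this value the series condition bounds the widths from [k] on by [r / 2] in total, leaving
   [r / 2] for the equal ones. *)
pose B := 4 * A * lam.
have B0 : 0 < B by rewrite /B -mulrA; lra.
pose b i := (B * (i.+1%:R * m i))^-1.
have b0 i : 0 < b i.
  by rewrite invr_gt0 mulr_gt0 // mulr_gt0 ?weight_ratio_gt0 // ltr0n.
pose a i := if (i < k)%N then r / (2 * k%:R) else b i.
have a0 i : 0 < a i.
  rewrite /a; case: ifP => // ik; rewrite divr_gt0 // mulr_gt0 // ltr0n.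
  exact: leq_ltn_trans ik.
exists a; split=> //.
- move=> N; apply: (@le_trans _ _ (\sum_(0 <= i < k + N) a i)).
    rewrite addnC [leRHS](big_cat_nat (n := N)) ?leq_addr //=.
    by rewrite lerDl sumr_ge0 // => i _; apply: ltW.
  rewrite (big_cat_nat (n := k)) ?leq_addr //=.
  have -> : r = r / 2 + r / 2 by lra.
  apply: lerD.
    rewrite (eq_big_nat _ _ (F2 := fun=> r / (2 * k%:R))); last first.
      by move=> i /andP[_ ik]; rewrite /a ik.
    rewrite big_const_nat subn0 iter_addr_0.
    have [->|k0] := posnP k; first by rewrite mulr0n; lra.
    have k1 : k%:R != 0 :> R by rewrite pnatr_eq0 -lt0n.
    by rewrite -[X in X <= _]mulr_natr le_eqVlt; apply/orP; left; apply/eqP; field.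
  rewrite (eq_big_nat _ _ (F2 := b)); last first.
    by move=> i /andP[ki _]; rewrite /a ltnNge ki.
  have -> : \sum_(k <= i < k + N) b i =
      B^-1 * \sum_(k <= i < k + N) M i / (i.+1%:R * M i.+1).
    rewrite mulr_sumr; apply: eq_bigr => i _; rewrite /b /m invfM; congr (_ * _).
    by rewrite invfM invf_div invfM; ring.
  rewrite ler_pdivrMl //; apply: le_trans (HA _ _) _.
  have -> : B * (r / 2) = A * (2 * (lam * r)) by rewrite /B; field.
  rewrite ler_pM2l // -[M k / _]invrK invf_div -[leRHS]invrK.
  by rewrite lef_pV2 ?posrE ?weight_ratio_gt0 // invr_gt0 mulr_gt0.
(* The gain [2 ^+ (k - j)] offsets the factor [2 ^ (k + j)] incurred when [k ^ j] is replaced by a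
   factorial; only [4 ^ j] remains. *)
have key j : (j <= k)%N -> hM M (lam * r) <= (lam * r) ^+ j * M j / 2 ^+ (k - j).
  move=> jk; apply: le_trans (hM_le k (ltW lr0)) _.
  rewrite -{1 2}(subnKC jk).
  have : (k - j <= k - j)%N by [].
  elim: {1 3 4 5}(k - j)%N => [|i IH] ik; first by rewrite addn0 expr0 divr1.
  have {}IH := IH (ltnW ik).
  have m1 : lam * r * m (j + i)%N <= 2^-1.
    rewrite mulrC -ler_pdivlMr // -invfM; apply/ltW/kmin.
    by lia.
  rewrite addnS weightS -/(m _) exprS [2 ^+ i.+1]exprS invfM.
  set x := (lam * r) ^+ (j + i) in IH *; set y := M (j + i)%N in IH *.
  have -> : lam * r * x * (m (j + i)%N * y) = (lam * r * m (j + i)%N) * (x * y) by ring.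
  have -> : (lam * r) ^+ j * M j * (2^-1 / 2 ^+ i) =
    2^-1 * ((lam * r) ^+ j * M j / 2 ^+ i) by ring.
  apply: ler_pM => //.
    by rewrite mulr_ge0 // ltW // weight_ratio_gt0.
  by rewrite mulr_ge0 ?weight_ge0 // exprn_ge0 // ltW.
have s16 : 16 * lam <= sg by rewrite /sg; lra.
have low j : (j <= k)%N -> (\prod_(0 <= i < j) (2 / a i)) * hM M (lam * r)
       <= sg ^+ j * j`!%:R * M j.
  move=> jk; rewrite (eq_big_nat _ _ (F2 := fun=> 4 * k%:R / r)); last first.
    move=> i /andP[_ ij]; rewrite /a (leq_trans ij jk) invf_div mulrA.
    by congr (_ / _); ring.
  rewrite prodr_const_nat subn0.
  apply: (@le_trans _ _ ((4 * k%:R / r) ^+ j * ((lam * r) ^+ j * M j / 2 ^+ (k - j)))).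
    by rewrite ler_wpM2l ?key // exprn_ge0 // divr_ge0 ?mulr_ge0 ?ler0n // ltW.
  have kj := expn_le_fact_exp2 j k.
  have {kj} kj : k%:R ^+ j <= j`!%:R * 2 ^+ (k + j) :> R.
    by rewrite -natrX -natrX -natrM ler_nat.
  have -> : (4 * k%:R / r) ^+ j * ((lam * r) ^+ j * M j / 2 ^+ (k - j)) =
     (k%:R ^+ j / 2 ^+ (k - j)) * ((4 * lam) ^+ j * M j).
    have rr : (4 * k%:R / r) ^+ j * (lam * r) ^+ j = k%:R ^+ j * (4 * lam) ^+ j.
      by rewrite -!exprMn; congr (_ ^+ _); field; rewrite gt_eqF.
    by rewrite mulrA mulrA rr; ring.
  have -> : sg ^+ j * j`!%:R * M j = (j`!%:R * (sg / (4 * lam)) ^+ j) * ((4 * lam) ^+ j * M j).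
    rewrite [in RHS]expr_div_n; field.
    by rewrite expf_neq0 // gt_eqF // mulr_gt0.
  rewrite ler_wpM2r //.
    by rewrite mulr_ge0 ?weight_ge0 // exprn_ge0 // mulr_ge0 // ltW.
  rewrite ler_pdivrMr ?exprn_gt0 //; apply: le_trans kj _.
  rewrite -mulrA ler_wpM2l ?ler0n //.
  have -> : (k + j = j + j + (k - j))%N by lia.
  rewrite exprD ler_wpM2r ?exprn_ge0 // addnn -mul2n exprM lerXn2r ?nnegrE ?exprn_ge0 //.
    by rewrite divr_ge0 // ltW // mulr_gt0.
  rewrite ler_pdivlMr ?mulr_gt0 // expr2; lra.
(* Beyond [k], passing from order i to i+1 multiplies the product by [2 * B] times (i+1) M_(i+1) /
   M_i, which is the growth of i! M_i. *)
move=> j; have [/low //|/ltnW /subnK <-] := leqP j k.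
elim: (j - k)%N => [|i IH]; first exact: low.
rewrite addSn big_nat_recr //= mulrAC.
apply: (@le_trans _ _ (sg ^+ (i + k) * (i + k)`!%:R * M (i + k)%N * (2 / a (i + k)%N))).
  by rewrite ler_wpM2r // divr_ge0 // ltW.
rewrite /a ltnNge leq_addl /= invrK factS natrM exprS weightS -/(m _).
set x := (i + k)%N.
have -> : sg ^+ x * x`!%:R * M x * (2 * (B * (x.+1%:R * m x))) =
   (2 * B) * (sg ^+ x * x`!%:R * M x * (x.+1%:R * m x)) by ring.
have -> : sg * sg ^+ x * (x.+1%:R * x`!%:R) * (m x * M x) =
   sg * (sg ^+ x * x`!%:R * M x * (x.+1%:R * m x)) by ring.
rewrite ler_wpM2r //.
  by rewrite !mulr_ge0 ?invr_ge0 ?weight_ge0 ?exprn_ge0 ?ler0n // ltW.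
by rewrite /sg /B; lra.
Qed.

End WeightSequence.

(** * Smooth steps in one variable *)

Section OneVariable.
Context {R : realType}.
Implicit Types (f g h : R -> R) (a b x y : R) (l : seq R).

Definition has_deriv f g := forall x : R, is_derive x (1 : R) f (g x).

Lemma has_deriv_continuous f g : has_deriv f g -> continuous f.
Proof.
by move=> fg x; apply/differentiable_continuous/derivable1_diffP; case: (fg x).
Qed.

Lemma has_deriv_MVT f g x y : has_deriv f g -> x < y ->
  exists2 c, x < c < y & f y - f x = g c * (y - x).
Proof.
move=> fg xy; have [||c cxy E] := @MVT R f g x y xy.
- by move=> z _; apply: fg.
- by apply: continuous_subspaceT; apply: has_deriv_continuous fg.
- by exists c => //; move: cxy; rewrite in_itv.
Qed.

(** Two mean value steps give [C] instead of C/2. A bound of this form survives pointwise limits,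
    which is how limits and series are differentiated below. *)
Lemma has_deriv_taylor2 f g h C : has_deriv f g -> has_deriv g h ->
  (forall x, `|h x| <= C) ->
  forall x y, `|f y - f x - (y - x) * g x| <= C * (y - x) ^+ 2.
Proof.
move=> fg gh hC x y.
have lip u w : u <= w -> `|g w - g u| <= C * (w - u).
  rewrite le_eqVlt => /predU1P[->|uw]; first by rewrite !subrr normr0 mulr0.
  have [c _ ->] := has_deriv_MVT gh uw.
  have ? : 0 <= w - u by rewrite subr_ge0 ltW.
  by rewrite normrM (ger0_norm (_ : 0 <= w - u)) // ler_wpM2r.
have C0 : 0 <= C := le_trans (normr_ge0 _) (hC 0).
have [xy|yx|->] := ltgtP x y; last by rewrite !subrr mul0r subrr normr0 expr0n mulr0.
- have [c /andP[xc cy] E] := has_deriv_MVT fg xy.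
  rewrite E -[(y - x) * _]mulrC -mulrBl normrM expr2 mulrA.
  have ? : 0 <= y - x by rewrite subr_ge0 ltW.
  rewrite (ger0_norm (_ : 0 <= y - x)) // ler_wpM2r //.
  by apply: le_trans (lip _ _ (ltW xc)) _; rewrite ler_wpM2l // lerB // ltW.
- have [c /andP[yc cx] E] := has_deriv_MVT fg yx.
  have -> : f y - f x = g c * (y - x) by rewrite -opprB E; ring.
  rewrite -[(y - x) * _]mulrC -mulrBl normrM expr2 mulrA.
  have ? : y - x <= 0 by rewrite subr_le0 ltW.
  have -> : C * (y - x) * (y - x) = C * (x - y) * (x - y) by ring.
  rewrite (ler0_norm (_ : y - x <= 0)) // opprB ler_wpM2r ?subr_ge0 ?(ltW yx) //.
  rewrite distrC; apply: le_trans (lip _ _ (ltW cx)) _.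
  by rewrite ler_wpM2l // lerB // ltW.
Qed.

Lemma is_derive_eps f x d :
  (forall eps, 0 < eps -> \forall y \near x, `|f y - f x - (y - x) * d| <= eps * `|y - x|) ->
  is_derive x (1 : R) f d.
Proof.
move=> Hf.
have H : h^-1 *: ((f \o shift x) (h *: (1 : R)) - f x) @[h --> 0^'] --> d.
  apply/cvgrPdist_le => eps eps0.
  have /nbhs_ballP[e /= e0 He] := Hf eps eps0.
  near=> h => /=.
  have h0 : h != 0 by near: h; apply: nbhs_dnbhs_neq.
  have hx : `|h| < e by near: h; apply: dnbhs0_lt.
  have := He (h + x); rewrite /ball /= opprD addrCA subrr addr0 normrN => /(_ hx).
  rewrite addrK => Hh.
  rewrite -[_%:A]/(h * 1) mulr1 -[_ *: _]/(_ * _) distrC.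
  have -> : h^-1 * (f (h + x) - f x) - d = h^-1 * (f (h + x) - f x - h * d).
    by rewrite [RHS]mulrBr mulKf.
  by rewrite normrM normfV ler_pdivrMl ?normr_gt0 // [leRHS]mulrC.
apply: DeriveDef; first exact: cvgP H.
exact: cvg_lim H.
Unshelve. all: by end_near. Qed.

Lemma is_derive_quadratic f x d C :
  (\forall y \near x, `|f y - f x - (y - x) * d| <= C * (y - x) ^+ 2) ->
  is_derive x (1 : R) f d.
Proof.
move=> H; apply: is_derive_eps => eps eps0; near=> y.
have he : `|y - x| <= eps / (`|C| + 1).
  rewrite distrC; near: y; have /cvgrPdist_le := @cvg_id R (nbhs x); apply.
  by rewrite divr_gt0 // ltr_pwDr.
apply: (@le_trans _ _ (C * (y - x) ^+ 2)); first by near: y.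
rewrite -[(y - x) ^+ 2]real_normK ?num_real // expr2 mulrA ler_wpM2r //.
apply: (@le_trans _ _ ((`|C| + 1) * `|y - x|)).
  by rewrite ler_wpM2r // (le_trans (ler_norm _)) // lerDl.
by rewrite -ler_pdivlMl ?ltr_pwDr // mulrC.
Unshelve. all: by end_near. Qed.

(** Applied to a primitive of g, this is the mean of g over [[x - a, x]], that is, the convolution
    of g with a uniform density. *)
Definition dq a f x := (f x - f (x - a)) / a.

Lemma has_deriv_shift a f g : has_deriv f g ->
  has_deriv (fun x => f (x + a)) (fun x => g (x + a)).
Proof.
move=> fg x.
have gx : is_derive x (1 : R) (fun y : R => y + a) 1.
  by rewrite -[X in is_derive _ _ _ X]addr0; apply: is_deriveD.
have := @is_derive1_comp R f (fun y : R => y + a) x _ _ (fg (x + a)) gx.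
by rewrite mulr1.
Qed.

Lemma has_derivB f f' g g' : has_deriv f f' -> has_deriv g g' ->
  has_deriv (fun x => f x - g x) (fun x => f' x - g' x).
Proof. by move=> ff gg x; apply: is_deriveB. Qed.

Lemma has_deriv_dq a f g : has_deriv f g -> has_deriv (dq a f) (dq a g).
Proof.
move=> fg x; have /(_ x) H := has_derivB fg (has_deriv_shift (- a) fg).
rewrite (_ : dq a f = a^-1 \*: (fun x => f x - f (x - a))); last first.
  by apply/funext => y; rewrite /dq mulrC.
rewrite (_ : dq a g x = a^-1 *: (g x - g (x - a))); last by rewrite /dq mulrC.
exact: is_deriveZ.
Qed.

Lemma dq_MVT a f g x : 0 < a -> has_deriv f g ->
  exists2 c, x - a < c < x & dq a f x = g c.
Proof.
move=> a0 fg; have [|c cx E] := @has_deriv_MVT f g (x - a) x fg; first lra.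
by exists c => //; rewrite /dq E; field; rewrite gt_eqF.
Qed.

Lemma dqC a b f : dq a (dq b f) = dq b (dq a f).
Proof.
apply/funext => x; rewrite /dq.
have -> : x - b - a = x - a - b by ring.
by ring.
Qed.

Lemma dq_norm_le a f C : 0 < a -> (forall x, `|f x| <= C) ->
  forall x, `|dq a f x| <= 2 / a * C.
Proof.
move=> a0 fC x; rewrite /dq normrM normfV (gtr0_norm a0) mulrC -mulrA mulrCA.
rewrite ler_pM2l ?invr_gt0 //; apply: le_trans (ler_normB _ _) _.
by have := fC x; have := fC (x - a); lra.
Qed.

Definition dqs l f := foldr dq f l.

Lemma has_deriv_dqs l f g : has_deriv f g -> has_deriv (dqs l f) (dqs l g).
Proof. by move=> fg; elim: l => //= a l; apply: has_deriv_dq. Qed.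

Lemma dqs_rcons l b f : dqs (rcons l b) f = dq b (dqs l f).
Proof. by elim: l => //= a l ->; rewrite dqC. Qed.

(** Truncated powers, the iterated primitives of the Heaviside step. *)
Definition tpow (k : nat) x : R := if x <= 0 then 0 else x ^+ k / k`!%:R.

(** The indices start here because [tpow 1] has a corner at 0; this is why derivatives of [bspline]
    are taken only from two widths on. *)
Lemma has_deriv_tpow k : has_deriv (tpow k.+2) (tpow k.+1).
Proof.
move=> x; have [x0|x0|->] := ltgtP x 0.
- apply: (@near_eq_is_derive _ _ _ (cst 0)).
    near=> y; rewrite /tpow /=; suff -> : y <= 0 by [].
    by apply: ltW; near: y; apply: lt_nbhsl.
  by rewrite /tpow (ltW x0); apply: is_derive_cst.
- apply: (@near_eq_is_derive _ _ _ (((k.+2)`!%:R)^-1 \*: (fun y : R => y ^+ k.+2))).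
    near=> y; rewrite /tpow /= leNgt.
    suff -> : 0 < y by rewrite /= mulrC.
    by near: y; apply: lt_nbhsr.
  have -> : tpow k.+1 x = ((k.+2)`!%:R)^-1 *: (x ^+ k.+1 *+ k.+2).
    rewrite /tpow leNgt x0 /= -[_ *: _]/(_ * _) -[_ *+ k.+2]mulr_natr [(k.+2)`!]factS natrM.
    have h1 : (k.+1)`!%:R != 0 :> R by rewrite pnatr_eq0 -lt0n fact_gt0.
    have h2 : k.+2%:R != 0 :> R by rewrite pnatr_eq0.
    move: (k.+2%:R) h2 => z h2. field; exact/andP.
  apply: is_deriveZ.
  have := @is_deriveX R R id k.+2 x (1 : R) 1 (is_derive_id _ _).
  rewrite -[_ *: 1]/(_ * 1) mulr1 /= => H.
  rewrite (_ : (fun y : R => y ^+ k.+2) = (id : R -> R) ^+ k.+2); last first.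
    by apply/funext => y; rewrite fctE.
  by rewrite -[_ *+ _]mulr_natl.
- apply: (@is_derive_quadratic _ _ _ 1).
  near=> y; rewrite /tpow lexx subr0 mulr0 !subr0 mul1r.
  have y1 : `|y| <= 1.
    rewrite -[y]subr0 distrC; near: y.
    by have /cvgrPdist_le := @cvg_id R (nbhs 0); apply.
  case: ifP => y0; first by rewrite normr0 sqr_ge0.
  rewrite normrM normrX normfV (ger0_norm (ler0n _ _)) ler_pdivrMr ?ltr0n ?fact_gt0 //.
  rewrite -[y ^+ 2]real_normK ?num_real // -[X in X <= _]mulr1; apply: ler_pM.
  + exact: exprn_ge0.
  + exact: ler01.
  + by rewrite -addn2 exprD ler_piMl ?exprn_ge0 // exprn_ile1.
  + by rewrite ler1n fact_gt0.
Unshelve. all: by end_near. Qed.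

(* [bspline l] is the distribution function of a sum of independent uniform
   variables on the intervals [[0, a]], [a] ranging over [l]. *)
Definition bspline l := dqs l (tpow (size l)).

Lemma has_deriv_bspline_prim l :
  l != [::] -> has_deriv (dqs l (tpow (size l).+1)) (bspline l).
Proof. by case: l => // a l _; apply: has_deriv_dqs; apply: has_deriv_tpow. Qed.

Lemma has_deriv_bspline a l :
  l != [::] -> has_deriv (bspline (a :: l)) (dq a (bspline l)).
Proof. by move=> /has_deriv_bspline_prim; apply: has_deriv_dq. Qed.

Lemma bspline_rcons_MVT l b x : 0 < b -> l != [::] ->
  exists2 c, x - b < c < x & bspline (rcons l b) x = bspline l c.
Proof.
move=> b0 /has_deriv_bspline_prim H; rewrite /bspline size_rcons dqs_rcons.
exact: dq_MVT b0 H.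
Qed.

(** A further width [a] replaces the function by its mean over [[x - a, x]], which by the mean value
    theorem is one of its values there; monotonicity and the two constant ends survive. *)
Lemma bspline_props a l : (forall b, b \in a :: l -> 0 < b) ->
  [/\ {homo bspline (a :: l) : x y / x <= y},
      forall x, x <= 0 -> bspline (a :: l) x = 0 &
      forall x, \sum_(b <- a :: l) b <= x -> bspline (a :: l) x = 1].
Proof.
elim: l a => [a Ha|b l IH a Ha].
  have a0 : 0 < a by apply: Ha; rewrite mem_head.
  have t1 : tpow 1 = fun x => if x <= 0 then 0 else x.
    by apply/funext => x; rewrite /tpow expr1 divr1.
  rewrite /bspline /= t1 /dq; split.
  - move=> x y xy /=; rewrite ler_pM2r ?invr_gt0 //.
    by do 4 case: ifPn; rewrite -?ltNge; lra.
  - by move=> x x0; do 2 case: ifPn; rewrite -?ltNge; rewrite ?subrr ?mul0r //; lra.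
  - move=> x; rewrite big_seq1 => ax; have -> : x <= 0 = false by apply/negbTE; rewrite -ltNge; lra.
    rewrite -[RHS](mulfV (lt0r_neq0 a0)); congr (_ / _).
    by case: ifPn; rewrite -?ltNge; lra.
have [|mo lo hi] := IH b.
  by move=> c cl; apply: Ha; rewrite inE cl orbT.
have a0 : 0 < a by apply: Ha; rewrite mem_head.
have prim := @has_deriv_bspline_prim (b :: l) isT.
have vE : bspline [:: a, b & l] = dq a (dqs (b :: l) (tpow (size (b :: l)).+1)) by [].
move: (dqs (b :: l) _) prim vE => G prim ->.
split.
- move=> x y xy.
  have H := has_derivB (has_deriv_shift (y - x) prim) prim.
  have [c _ E] := dq_MVT x a0 H.
  have : 0 <= bspline (b :: l) (c + (y - x)) - bspline (b :: l) c.
    by rewrite subr_ge0 mo // lerDl subr_ge0.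
  rewrite -E /dq.
  have -> : x - a + (y - x) = y - a by ring.
  have -> : x + (y - x) = y by ring.
  move=> /= H0; rewrite -subr_ge0; apply: le_trans H0 _.
  by rewrite le_eqVlt; apply/orP; left; apply/eqP; ring.
- move=> x x0; have [c /andP[_ cx] E] := dq_MVT x a0 prim.
  by rewrite E lo //; lra.
- move=> x; rewrite big_cons => sx; have [c /andP[xc _] E] := dq_MVT x a0 prim.
  by rewrite E hi //; lra.
Qed.

Lemma bspline_ge0_le1 a l x : (forall b, b \in a :: l -> 0 < b) ->
  0 <= bspline (a :: l) x <= 1.
Proof.
move=> /bspline_props[mo lo hi]; apply/andP; split.
  rewrite -(lo (Num.min x 0)) ?ge_min ?lexx ?orbT //.
  by apply: mo; rewrite ge_min lexx.
rewrite -(hi (Num.max x (\sum_(b <- a :: l) b))) ?le_max ?lexx ?orbT //.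
by apply: mo; rewrite le_max lexx.
Qed.

(** * Infinite convolutions of uniform densities *)

Section InfiniteConvolution.
Variables (a : nat -> R).
Hypothesis a0 : forall i, 0 < a i.

(** The starting index stays free because differentiation removes the first width: the derivative of
    the limit for [j] is a difference quotient of the limit for [j.+1]. *)
Let V j N := bspline [seq a i | i <- iota j N.+1].

Let Vpos j N b : b \in [seq a i | i <- iota j N.+1] -> 0 < b.
Proof. by move=> /mapP[i _ ->]. Qed.

Let V01 j N x : 0 <= V j N x <= 1.
Proof. by apply: bspline_ge0_le1; apply: (@Vpos j N). Qed.

(** One more nonnegative summand can only lower a distribution function; this monotonicity gives the
    limit in [N]. *)
Let VS j N x : V j N.+1 x <= V j N x.
Proof.
have [mo _ _] := @bspline_props (a j) [seq a i | i <- iota j.+1 N] (@Vpos j N).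
rewrite /V -[iota j N.+2]/(iota j (N.+2)) -[N.+2]addn1 iotaD map_cat /= cats1.
have [c /andP[_ cx] ->] := @bspline_rcons_MVT [seq a i | i <- iota j N.+1]
  (a (j + N.+1)%N) x (a0 _) isT.
exact/mo/ltW.
Qed.

Let lbV j x : has_lbound (range (fun N => V j N x)).
Proof. by exists 0 => _ [N _ <-]; case/andP: (V01 j N x). Qed.

Let u j x := inf (range (fun N => V j N x)).

Let V_cvg j x : V j N x @[N --> \oo] --> u j x.
Proof.
apply: nonincreasing_cvgn (lbV j x).
by apply/nonincreasing_seqP => N; apply: VS.
Qed.

Let u01 j x : 0 <= u j x <= 1.
Proof.
apply/andP; split.
  apply: lb_le_inf; first by exists (V j 0 x), 0%N.
  by move=> _ [N _ <-]; case/andP: (V01 j N x).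
apply: (@le_trans _ _ (V j 0 x)); last by case/andP: (V01 j 0 x).
by apply: ge_inf => //; exists 0%N.
Qed.

Let VSS_cvg j k x : V j (N + k)%N x @[N --> \oo] --> u j x.
Proof. by have := @V_cvg j x; rewrite -(cvg_shiftn k). Qed.

(** With at least three widths, the second derivative of [V j] is a double difference quotient of
    some [V j.+2 N], hence bounded independently of [N]. The resulting Taylor bound passes to the
    limit. *)
Let u_deriv j : has_deriv (u j) (dq (a j) (u j.+1)).
Proof.
move=> x; pose C := 2 / a j * (2 / a j.+1 * 1).
apply: (@is_derive_quadratic _ _ _ C); near=> y.
have T N : `|V j (N + 2) y - V j (N + 2) x - (y - x) * dq (a j) (V j.+1 (N + 1)%N) x|
    <= C * (y - x) ^+ 2.
  rewrite addn2 addn1.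
  apply: (@has_deriv_taylor2 _ _ (dq (a j) (dq (a j.+1) (V j.+2 N)))).
  - exact: has_deriv_bspline.
  - by apply: has_deriv_dq; apply: has_deriv_bspline.
  - apply: dq_norm_le => //; apply: dq_norm_le => // z.
    by have /andP[? ?] := V01 j.+2 N z; rewrite ger0_norm.
have cv : `|V j (N + 2)%N y - V j (N + 2)%N x - (y - x) * dq (a j) (V j.+1 (N + 1)%N) x|
   @[N --> \oo] --> `|u j y - u j x - (y - x) * dq (a j) (u j.+1) x|.
  apply: cvg_norm; apply: cvgB; first by apply: cvgB; apply: VSS_cvg.
  apply: cvgMr; rewrite /dq; apply: cvgMl.
  by apply: cvgB; apply: VSS_cvg.
rewrite -(cvg_lim _ cv) //; apply: limr_le; first exact: cvgP cv.
by near=> N; apply: T.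
Unshelve. all: by end_near. Qed.

(** The j-th derivative uses up the first j widths as difference quotients of [u j], which takes
    values in [[0, 1]]; each quotient costs a factor [2 / a i]. *)
Lemma smooth_step r : (forall N, \sum_(0 <= i < N) a i <= r) ->
  exists th : nat -> R -> R,
  [/\ forall j, has_deriv (th j) (th j.+1),
      forall x, x <= 0 -> th 0%N x = 0,
      forall x, r <= x -> th 0%N x = 1 &
      forall j x, `|th j x| <= \prod_(0 <= i < j) (2 / a i)].
Proof.
move=> Hr; exists (fun j => dqs [seq a i | i <- iota 0 j] (u j)); split.
- move=> j; rewrite -[j.+1]addn1 iotaD map_cat cats1 dqs_rcons add0n addn1.
  have -> : dq (a j) (dqs [seq a i | i <- iota 0 j] (u j.+1)) =
    dqs [seq a i | i <- iota 0 j] (dq (a j) (u j.+1)).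
    by elim: (iota 0 j) => //= i s <-; rewrite dqC.
  exact/has_deriv_dqs/u_deriv.
- move=> x x0 /=; apply/eqP; rewrite eq_le; case/andP: (u01 0 x) => -> _.
  rewrite andbT; have [_ lo _] := @bspline_props (a 0%N) [::] (@Vpos 0 0).
  by rewrite -(lo x x0); apply: ge_inf => //; exists 0%N.
- move=> x rx /=; apply/eqP; rewrite eq_le; case/andP: (u01 0 x) => _ ->.
  apply: lb_le_inf; first by exists (V 0 0 x), 0%N.
  move=> _ [N _ <-]; have [_ _ hi] := @bspline_props _ _ (@Vpos 0 N).
  rewrite /V -[iota 0 N.+1]/(0%N :: iota 1 N) /= hi //; apply: le_trans rx.
  by rewrite -[a 0%N :: _]/([seq a i | i <- iota 0 N.+1]) big_map -[iota 0 _]/(index_iota 0 N.+1).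
- move=> j x; rewrite unlock /= /reducebig /index_iota subn0.
  elim: (iota 0 j) x => [|i s IH] x /=.
    by have /andP[? ?] := u01 j x; rewrite ger0_norm.
  exact: dq_norm_le.
Qed.

End InfiniteConvolution.
End OneVariable.

(** * Smooth functions of several variables *)

(* Locked copies: comparing a partial derivative with an unrelated function by
   conversion unfolds the limit defining it and does not end in reasonable time. *)
HB.lock Definition pd {R : realType} {n : nat} (i : 'I_n) (f : 'rV[R]_n -> R)
  : 'rV[R]_n -> R := pderiv i f.

HB.lock Definition C1on {R : realType} {n : nat} (O : set 'rV[R]_n) (f : 'rV[R]_n -> R) : Prop :=
  forall x, O x -> {for x, continuous f} /\ (forall i, derivable f x (evec i)).

Definition ipd {R : realType} {n : nat} (s : seq 'I_n) (f : 'rV[R]_n -> R) : 'rV[R]_n -> R :=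
  foldr pd f s.

HB.lock Definition smooth {R : realType} {n : nat} (O : set 'rV[R]_n) (f : 'rV[R]_n -> R) : Prop :=
  forall s : seq 'I_n, C1on O (ipd s f).

Section Smooth.
Context {R : realType} {n : nat}.
Local Notation V := 'rV[R]_n.
Implicit Types (f g h : V -> R) (O U : set V) (i j : 'I_n) (s t : seq 'I_n).

Lemma entry_norm_le (x : V) i : `|x ord0 i| <= `|x|.
Proof.
rewrite -[leRHS]/(mx_norm x) mx_normrE.
exact: (@le_bigmax _ _ _ 0 (fun k : 'I_1 * 'I_n => `|x k.1 k.2|) (ord0, i)).
Qed.

Lemma rV_norm_le (x : V) (r : R) : 0 <= r -> (forall i, `|x ord0 i| <= r) -> `|x| <= r.
Proof.
move=> r0 H; rewrite -[leLHS]/(mx_norm x) mx_normrE bigmax_le // => -[k i] _ /=.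
by rewrite (ord1 k).
Qed.

Lemma rV_norm_lt (x : V) (r : R) : 0 < r -> (forall i, `|x ord0 i| < r) -> `|x| < r.
Proof.
move=> r0 H; rewrite -[ltLHS]/(mx_norm x) mx_normrE bigmax_lt // => -[k i] _ /=.
by rewrite (ord1 k).
Qed.

Lemma norm_scale_evec (c : R) i : `|c *: evec i : V| <= `|c|.
Proof.
apply: rV_norm_le => // k; rewrite !mxE eqxx /= normrM.
by rewrite -[leRHS]mulr1 ler_wpM2l // normr_nat lern1 leq_b1.
Qed.

Lemma ball_normE (x y : V) (r : R) : ball x r y <-> `|y - x| < r.
Proof. by rewrite -ball_normE /ball_ /= distrC. Qed.

Lemma open_ball_sub O x : open O -> O x ->
  exists2 r : R, 0 < r & forall y, `|y - x| < r -> O y.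
Proof.
move=> oO Ox; have /nbhs_ballP[r /= r0 H] := open_nbhs_nbhs (conj oO Ox).
by exists r => // y /ball_normE; apply: H.
Qed.

Lemma near_norm (x : V) (P : V -> Prop) :
  (\forall y \near x, P y) <-> exists2 r : R, 0 < r & forall y, `|y - x| < r -> P y.
Proof.
split=> [/nbhs_ballP[r /= r0 H]|[r r0 H]].
  by exists r => // y /ball_normE; apply: H.
by apply/nbhs_ballP; exists r => //= y /ball_normE; apply: H.
Qed.

Lemma continuous_epsP f (x : V) : {for x, continuous f} <->
  forall eps : R, 0 < eps -> exists2 r : R, 0 < r &
    forall y, `|y - x| < r -> `|f y - f x| <= eps.
Proof.
split=> [/cvgrPdist_le cf eps e0|H].
  have /near_norm[r r0 H] := cf eps e0.
  by exists r => // y /H; rewrite distrC.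
apply: (iffRL (cvgrPdist_le (F := nbhs x) f (f x))) => eps e0.
have [r r0 Hr] := H eps e0.
by apply/near_norm; exists r => // y /Hr; rewrite distrC.
Qed.

Lemma is_derive_line f (x v : V) (d : R) :
  is_derive x v f d <-> is_derive (0 : R) (1 : R) (fun h : R => f (h *: v + x)) d.
Proof.
have E : (fun h : R => h^-1 *: ((f \o shift x) (h *: v) - f x)) =
  (fun h : R => h^-1 *: (((fun k : R => f (k *: v + x)) \o shift 0) (h *: (1 : R)) -
     (fun k : R => f (k *: v + x)) 0)).
  by rewrite funeqE => h /=; rewrite addr0 scale0r add0r [_%:A]mulr1.
split=> -[D <-]; apply: DeriveDef; rewrite /derivable /derive -?E //.
by rewrite E.
Qed.

Lemma is_derive_along f (z v : V) (t d : R) : is_derive (t *: v + z) v f d ->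
  is_derive t (1 : R) (fun u : R => f (u *: v + z)) d.
Proof.
move=> [D <-].
have E : (fun h : R => h^-1 *: (((fun u : R => f (u *: v + z)) \o shift t) (h *: (1 : R)) -
     (fun u : R => f (u *: v + z)) t)) =
  (fun h : R => h^-1 *: ((f \o shift (t *: v + z)) (h *: v) - f (t *: v + z))).
  by rewrite funeqE => h /=; rewrite [_%:A]mulr1 scalerDl addrA.
by apply: DeriveDef; rewrite /derivable /derive E.
Qed.

Lemma C1onP O f : C1on O f <-> forall x, O x ->
  {for x, continuous f} /\ (forall i, derivable f x (evec i)).
Proof. by rewrite C1on.unlock. Qed.

Lemma pdE : @pd R n = pderiv.
Proof. by rewrite pd.unlock. Qed.

Lemma ipdE s f : ipd s f = iter_pderiv s f.
Proof. by rewrite /ipd pdE. Qed.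

Lemma smoothP O f : smooth O f <-> smooth_on O f.
Proof.
rewrite smooth.unlock; split=> [H s|H s].
  by rewrite -ipdE; apply/C1onP/H.
by apply/C1onP; rewrite ipdE; apply: H.
Qed.

Lemma C1on_is_derive O f x i : C1on O f -> O x -> is_derive x (evec i) f (pd i f x).
Proof. by move=> /C1onP Cf /Cf[_ /(_ i) D]; apply: DeriveDef; rewrite ?pdE. Qed.

Lemma line_MVT O f i (z : V) (c : R) : C1on O f ->
  (forall y, `|y - z| <= `|c| -> O y) ->
  exists2 y, `|y - z| <= `|c| & f (c *: evec i + z) - f z = c * pd i f y.
Proof.
move=> Cf Oz.
pose g (u : R) := f ((u * c) *: evec i + z).
have nrm (u : R) : 0 <= u <= 1 -> `|(u * c) *: evec i + z - z| <= `|c|.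
  move=> /andP[u0 u1]; rewrite addrK; apply: le_trans (norm_scale_evec _ _) _.
  by rewrite normrM (ger0_norm u0) ler_piMl.
have dg (u : R) : 0 <= u <= 1 ->
    is_derive u (1 : R) g (pd i f ((u * c) *: evec i + z) * c).
  move=> u01.
  have D1 : is_derive (u * c) (1 : R) (fun w : R => f (w *: evec i + z))
      (pd i f ((u * c) *: evec i + z)).
    by apply: is_derive_along; apply: (C1on_is_derive _ Cf); apply: Oz; apply: nrm.
  have D2 : is_derive u (1 : R) (fun w : R => w * c) c.
    rewrite (_ : (fun w : R => w * c) = c \*: id); last by apply/funext => w /=; rewrite mulrC.
    by rewrite -[X in is_derive _ _ _ X]mulr1; apply: is_deriveZ.
  exact: (@is_derive1_comp R (fun w : R => f (w *: evec i + z)) (fun w : R => w * c) u _ _ D1 D2).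
have [||w w01 E] := @MVT_segment R g (fun u => pd i f ((u * c) *: evec i + z) * c) 0 1 ler01.
- by move=> u; rewrite in_itv /= => /andP[u0 u1]; apply: dg; rewrite !ltW.
- apply: derivable_within_continuous => u; rewrite in_itv /= => u01.
  by have [] := dg u u01.
exists ((w * c) *: evec i + z); first by apply: nrm; move: w01; rewrite in_itv.
by move: E; rewrite /g mul1r mul0r scale0r add0r subr0 mulr1 mulrC.
Qed.

Lemma near_eq_continuous (f g : V -> R) (x : V) : (\forall y \near x, f y = g y) ->
  {for x, continuous f} -> {for x, continuous g}.
Proof.
move=> fg; rewrite /prop_for /continuous_at -(nbhs_singleton fg) => cf.
by apply: cvg_trans cf; exact: near_eq_cvg fg.
Qed.

Lemma open_eq_near O f g x : open O -> O x -> (forall y, O y -> f y = g y) ->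
  \forall y \near x, f y = g y.
Proof.
move=> oO Ox fg.
have [r r0 H] := open_ball_sub oO Ox.
by apply/near_norm; exists r => // y /H; apply: fg.
Qed.

Lemma C1on_eq O f g : open O -> (forall y, O y -> f y = g y) -> C1on O f -> C1on O g.
Proof.
move=> oO fg /C1onP Cf; apply/C1onP => x Ox; have [c d] := Cf x Ox; have N := open_eq_near oO Ox fg.
split; first exact: near_eq_continuous N c.
by move=> i; apply: near_eq_derivable (d i).
Qed.

Lemma eq_on_pd O f g i : open O -> (forall y, O y -> f y = g y) ->
  forall y, O y -> pd i f y = pd i g y.
Proof. by move=> oO fg y Oy; rewrite pdE; apply: near_eq_derive; apply: open_eq_near oO Oy fg. Qed.

Lemma eq_on_iter O f g s : open O -> (forall y, O y -> f y = g y) ->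
  forall y, O y -> ipd s f y = ipd s g y.
Proof. by move=> oO fg; elim: s => //= i s IH; apply: eq_on_pd. Qed.

Lemma ipd_cat s t f : ipd (s ++ t) f = ipd s (ipd t f).
Proof. exact: foldr_cat. Qed.

Lemma smooth_C1 O f s : smooth O f -> C1on O (ipd s f).
Proof. by rewrite smooth.unlock. Qed.

Lemma smooth_iter O f t : smooth O f -> smooth O (ipd t f).
Proof. by rewrite smooth.unlock => sf s; rewrite -ipd_cat. Qed.

Lemma smooth_sub O U f : U `<=` O -> smooth O f -> smooth U f.
Proof. by move=> UO /smoothP sf; apply/smoothP => s x /UO/sf. Qed.

(** An invariant closed under partial derivatives replaces explicit formulas for derivatives of
    every order. *)
Lemma smooth_coind O (F : (V -> R) -> Prop) : open O ->
  (forall f, F f -> C1on O f) ->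
  (forall f i, F f -> exists2 g, F g & forall x, O x -> pd i f x = g x) ->
  forall f, F f -> smooth O f.
Proof.
move=> oO HC HD f Ff; rewrite smooth.unlock => s.
suff [g Fg E] : exists2 g, F g & forall x, O x -> ipd s f x = g x.
  by apply: (C1on_eq oO (f := g)); [move=> y /E|exact: HC].
elim: s => [|i s [g Fg E]]; first by exists f.
have [h Fh E'] := HD g i Fg; exists h => // x Ox.
by rewrite /= (eq_on_pd i oO E Ox) E'.
Qed.

Lemma smooth_pd O f i : smooth O f -> smooth O (pd i f).
Proof. exact: (@smooth_iter O f [:: i]). Qed.

Lemma smooth_intro O f : (forall s, C1on O (ipd s f)) -> smooth O f.
Proof. by rewrite smooth.unlock. Qed.

Lemma smooth_eq O f g : open O -> (forall y, O y -> f y = g y) ->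
  smooth O f -> smooth O g.
Proof.
move=> oO fg sf; apply: smooth_intro => s; apply: (C1on_eq oO (f := ipd s f)).
  by move=> y Oy; apply: (eq_on_iter s oO fg Oy).
exact: (smooth_C1 s sf).
Qed.

Lemma C1onD O f g : C1on O f -> C1on O g -> C1on O (fun x => f x + g x).
Proof.
move=> /C1onP Cf /C1onP Cg; apply/C1onP => x Ox; have [[c d] [c' d']] := (Cf x Ox, Cg x Ox).
by split=> [|i]; [exact: continuousD|exact: derivableD].
Qed.

Lemma C1onM O f g : C1on O f -> C1on O g -> C1on O (fun x => f x * g x).
Proof.
move=> /C1onP Cf /C1onP Cg; apply/C1onP => x Ox; have [[c d] [c' d']] := (Cf x Ox, Cg x Ox).
by split=> [|i]; [exact: continuousM|exact: derivableM].
Qed.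

Lemma pdD O f g i x : C1on O f -> C1on O g -> O x ->
  pd i (fun x => f x + g x) x = pd i f x + pd i g x.
Proof.
move=> /C1onP Cf /C1onP Cg Ox; rewrite pdE; have [[_ d] [_ d']] := (Cf x Ox, Cg x Ox); exact: deriveD.
Qed.

Lemma pdM O f g i x : C1on O f -> C1on O g -> O x ->
  pd i (fun x => f x * g x) x = pd i f x * g x + f x * pd i g x.
Proof.
move=> /C1onP Cf /C1onP Cg Ox; rewrite pdE; have [[_ d] [_ d']] := (Cf x Ox, Cg x Ox).
by rewrite addrC [X in _ + X]mulrC; exact: deriveM.
Qed.

Lemma pd_cst i (c : R) (x : V) : pd i (fun=> c) x = 0.
Proof. rewrite pdE; exact: derive_cst. Qed.

Lemma pd_is_derive f i (x : V) (d : R) : is_derive x (evec i) f d -> pd i f x = d.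
Proof. by rewrite pdE; case. Qed.

Lemma smooth_cst O (c : R) : open O -> smooth O (fun=> c).
Proof.
move=> oO; apply: (@smooth_coind O (fun f => exists c, f = fun=> c)) => //; last by exists c.
  move=> _ [c' ->]; apply/C1onP => x Ox; split; first exact: cst_continuous.
  by move=> i; apply: derivable_cst.
move=> _ i [c' ->]; exists (fun=> 0); first by exists 0.
by move=> x Ox; apply: pd_cst.
Qed.

Lemma smoothD O f g : open O -> smooth O f -> smooth O g ->
  smooth O (fun x => f x + g x).
Proof.
move=> oO sf sg.
apply: (@smooth_coind O (fun h => exists u v,
  [/\ smooth O u, smooth O v & h = fun x => u x + v x])) => //; last by exists f, g.
  by move=> _ [u [v [su sv ->]]]; apply: C1onD; [exact: (smooth_C1 [::] su)|exact: (smooth_C1 [::] sv)].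
move=> _ i [u [v [su sv ->]]].
exists (fun x => pd i u x + pd i v x).
  by exists (pd i u), (pd i v); split=> //; [exact: smooth_pd|exact: smooth_pd].
by move=> x Ox; apply: (pdD _ (smooth_C1 [::] su) (smooth_C1 [::] sv) Ox).
Qed.

Lemma ipdD O f g s : open O -> smooth O f -> smooth O g ->
  forall x, O x -> ipd s (fun x => f x + g x) x = ipd s f x + ipd s g x.
Proof.
move=> oO sf sg; elim: s => //= i s IH x Ox.
rewrite (eq_on_pd i oO IH Ox).
exact: (pdD _ (smooth_C1 s sf) (smooth_C1 s sg) Ox).
Qed.

(** Products are not closed under differentiation, but their finite sums are: this is the invariant
    for [smoothM]. *)
Inductive sum_of_products O : (V -> R) -> Prop :=
| sum_of_products1 u v : smooth O u -> smooth O v ->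
    sum_of_products O (fun x => u x * v x)
| sum_of_products2 u v : sum_of_products O u -> sum_of_products O v ->
    sum_of_products O (fun x => u x + v x).

Lemma smoothM O f g : open O -> smooth O f -> smooth O g ->
  smooth O (fun x => f x * g x).
Proof.
move=> oO sf sg.
have HC h : sum_of_products O h -> C1on O h.
  elim=> [u v su sv|u v _ Cu _ Cv]; last exact: C1onD.
  by apply: C1onM; [exact: (smooth_C1 [::] su)|exact: (smooth_C1 [::] sv)].
apply: (@smooth_coind O (sum_of_products O)) => //; last by constructor.
move=> h i; elim=> [u v su sv|u v pu [u' Pu' Eu] pv [v' Pv' Ev]].
  exists (fun x => pd i u x * v x + u x * pd i v x).
    by do 2 constructor => //; [exact: smooth_pd|exact: smooth_pd].
  by move=> x Ox; apply: (pdM _ (smooth_C1 [::] su) (smooth_C1 [::] sv) Ox).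
exists (fun x => u' x + v' x); first exact: sum_of_products2.
by move=> x Ox; rewrite (pdD _ (HC _ pu) (HC _ pv) Ox) Eu // Ev.
Qed.

Lemma smoothV O f : open O -> smooth O f -> (forall x, O x -> f x != 0) ->
  smooth O (fun x => (f x)^-1).
Proof.
move=> oO sf f0.
have C1V : C1on O (fun x => (f x)^-1).
  apply/C1onP => x Ox; have [c d] := iffLR (C1onP _ _) (smooth_C1 [::] sf) x Ox; split.
    by apply: continuousV => //; apply: f0.
  by move=> i; apply: derivableV => //; apply: f0.
have C1P k : C1on O (fun x => (f x)^-1 ^+ k).
  elim: k => [|k IH]; first exact: (smooth_C1 [::] (smooth_cst 1 oO)).
  by rewrite (_ : (fun _ => _) = (fun x => (f x)^-1 * (f x)^-1 ^+ k)); [exact: C1onM|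
    apply/funext => x; rewrite exprS].
have dV i x : O x -> pd i (fun x => (f x)^-1) x = - (pd i f x * (f x)^-1 ^+ 2).
  move=> Ox; have [_ d] := iffLR (C1onP _ _) (smooth_C1 [::] sf) x Ox.
  apply: pd_is_derive; apply: DeriveDef; first by apply: derivableV => //; apply: f0.
  rewrite (deriveV (f0 _ Ox) (d i)) -[_ *: _]/(_ * _) exprVn mulNr mulrC.
  by rewrite (pd_is_derive (derivableP (d i))).
have dP i k x : O x -> pd i (fun x => (f x)^-1 ^+ k) x =
    - (k%:R * pd i f x * (f x)^-1 ^+ k.+1).
  move=> Ox; elim: k => [|k IH].
    by rewrite !mul0r oppr0; apply: pd_cst.
  rewrite (_ : (fun _ => _) = (fun x => (f x)^-1 * (f x)^-1 ^+ k)); last first.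
    by apply/funext => y; rewrite exprS.
  rewrite (pdM _ C1V (C1P k) Ox) IH dV // !exprS -natr1; ring.
(* The invariant is a smooth numerator over a power of [f]; a derivative raises the exponent by
   one. *)
apply: (@smooth_coind O (fun h => exists2 u, smooth O u & exists k,
   h = fun x => u x * (f x)^-1 ^+ k)) => //.
- by move=> _ [u su [k ->]]; apply: C1onM => //; exact: (smooth_C1 [::] su).
- move=> _ i [u su [k ->]].
  exists (fun x => (pd i u x * f x + (- k%:R) * (u x * pd i f x)) * (f x)^-1 ^+ k.+1).
    exists (fun x => pd i u x * f x + (- k%:R) * (u x * pd i f x)); last by exists k.+1.
    apply: smoothD => //; first by apply: smoothM => //; exact: smooth_pd.
    apply: smoothM => //; first exact: smooth_cst.
    by apply: smoothM => //; exact: smooth_pd.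
  move=> x Ox; rewrite (pdM _ (smooth_C1 [::] su) (C1P k) Ox) dP //= exprS.
  by field; exact: f0.
- exists (fun=> 1); first exact: smooth_cst.
  by exists 1%N; apply/funext => x; rewrite mul1r.
Qed.

Lemma smooth_prod O I (r : seq I) (F : I -> V -> R) : open O ->
  (forall k, smooth O (F k)) -> smooth O (fun x => \prod_(k <- r) F k x).
Proof.
move=> oO sF; elim: r => [|k r IH].
  by apply: (smooth_eq oO _ (smooth_cst 1 oO)) => x _; rewrite big_nil.
by apply: (smooth_eq oO _ (smoothM oO (sF k) IH)) => x _; rewrite big_cons.
Qed.

Lemma ipdZ O f (c : R) s : open O -> smooth O f ->
  forall x, O x -> ipd s (fun x => c * f x) x = c * ipd s f x.
Proof.
move=> oO sf; elim: s => //= i s IH x Ox.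
rewrite (eq_on_pd i oO IH Ox).
have C := smooth_C1 [::] (smooth_cst c oO).
by rewrite (pdM _ C (smooth_C1 s sf) Ox) pd_cst mul0r add0r.
Qed.

Lemma ipd_cst (c : R) s (x : V) : s != [::] -> ipd s (fun=> c) x = 0.
Proof.
case/lastP: s => // s i _; rewrite -cats1 ipd_cat /=.
have -> : pd i (fun=> c) = fun=> 0 by apply/funext => y; apply: pd_cst.
elim: s x => [//|j s IH x] /=; have -> : ipd s (fun=> 0 : R) = (fun=> 0).
  by apply/funext => y; apply: IH.
exact: pd_cst.
Qed.

Lemma is_derive_coord_comp (g : R -> R) (g' c d : R) (x : V) i k :
  is_derive (c * x ord0 i + d) (1 : R) g g' ->
  is_derive x (evec k) (fun y : V => g (c * y ord0 i + d)) (c * (k == i)%:R * g').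
Proof.
move=> Dg; apply/is_derive_line.
have E (h : R) : c * (h *: evec k + x) ord0 i + d = (c * (k == i)%:R) * h + (c * x ord0 i + d).
  by rewrite !mxE eqxx eq_sym /=; ring.
rewrite (_ : (fun h : R => _) = g \o (fun h : R => (c * (k == i)%:R) * h + (c * x ord0 i + d))).
  set k' := c * (k == i)%:R; set e := c * x ord0 i + d.
  have H1 : is_derive (k' * 0 + e) (1 : R) g g' by rewrite mulr0 add0r.
  have H2 : is_derive (0 : R) (1 : R) (fun h : R => k' * h + e) k'.
    have := is_deriveD (is_deriveZ k' (is_derive_id (0 : R) (1 : R))) (is_derive_cst e (0 : R) (1 : R)).
    by rewrite addr0 -[_ *: 1]/(_ * 1) mulr1.
  rewrite mulrC; exact: (@is_derive1_comp R g (fun h : R => k' * h + e) 0 _ _ H1 H2).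
by apply/funext => h /=; rewrite E.
Qed.

Lemma coord_comp_continuous (g : R -> R) (c d : R) i : continuous g ->
  continuous (fun y : V => g (c * y ord0 i + d)).
Proof.
move=> cg x; apply: (@continuous_comp _ _ _ (fun y : V => c * y ord0 i + d) g); last exact: cg.
apply: continuousD; last exact: cst_continuous.
apply: continuousM; first exact: cst_continuous.
exact: (@coord_continuous R 1 n ord0 i x).
Qed.

Lemma ipd_coord (th : nat -> R -> R) (c d : R) i s :
  (forall k, has_deriv (th k) (th k.+1)) ->
  ipd s (fun y : V => th 0%N (c * y ord0 i + d)) =
  fun y => c ^+ size s * (all (pred1 i) s)%:R * th (size s) (c * y ord0 i + d).
Proof.
move=> Hth; elim: s => [|k s IH]; first by apply/funext => y; rewrite /= expr0 !mul1r.
rewrite /= IH; apply/funext => y.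
have D := is_derive_coord_comp k (Hth (size s) (c * y ord0 i + d)).
rewrite (pd_is_derive (is_deriveZ (c ^+ size s * (all (pred1 i) s)%:R) D)).
rewrite -[_ *: _]/(_ * _) exprS; case: (k == i); case: (all _ _) => /=; ring.
Qed.

Lemma smooth_coord (th : nat -> R -> R) (c d : R) i :
  (forall k, has_deriv (th k) (th k.+1)) ->
  smooth setT (fun y : V => th 0%N (c * y ord0 i + d)).
Proof.
move=> Hth; apply: smooth_intro => s; apply/C1onP => x _; rewrite ipd_coord //; split.
  apply: continuousM; first exact: cst_continuous.
  by apply: coord_comp_continuous; apply: has_deriv_continuous (Hth _).
move=> k; apply: derivableM; first exact: derivable_cst.
by have [] := is_derive_coord_comp k (Hth (size s) (c * x ord0 i + d)).
Qed.

End Smooth.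

(** * Symmetry of mixed derivatives, Leibniz bounds and Taylor estimates *)

Section Calculus.
Context {R : realType} {n : nat}.
Local Notation V := 'rV[R]_n.
Implicit Types (f g h : V -> R) (O U : set V) (i j : 'I_n) (s t : seq 'I_n).

(* Telescoping over the coordinates reduces this to the mean value theorem along
   coordinate directions. *)
Lemma C1on_is_derive_dir O f (x v : V) : open O -> O x -> C1on O f ->
  (forall i, C1on O (pd i f)) ->
  is_derive x v f (\sum_i v ord0 i * pd i f x).
Proof.
move=> oO Ox Cf Cdf; apply/is_derive_line.
have -> : v = \sum_(i <- index_enum 'I_n) v ord0 i *: evec i by exact: row_sum_delta.
rewrite (eq_bigr (fun i => v ord0 i * pd i f x)); last first.
  by move=> i _; rewrite -row_sum_delta.
elim: (index_enum _) => [|i l IH].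
  rewrite !big_nil (_ : (fun h : R => _) = cst (f x)); first exact: is_derive_cst.
  by apply/funext => h; rewrite scaler0 add0r.
rewrite !big_cons; set w := \sum_(j <- l) _ in IH *; set c := v ord0 i.
pose e (h : R) := f ((h * c) *: evec i + (h *: w + x)) - f (h *: w + x).
suff He : is_derive (0 : R) (1 : R) e (c * pd i f x).
  rewrite (_ : (fun h : R => f _) = (e : R -> R) + (fun h : R => f (h *: w + x))).
    exact: is_deriveD.
  by apply/funext => h; rewrite fctE /e /= subrK scalerDr scalerA addrA.
have [r1 r10 Hr1] := open_ball_sub oO Ox.
apply: is_derive_eps => eps eps0.
have c0 : 0 < `|c| + 1 by rewrite ltr_pwDr.
have [ci _] := iffLR (C1onP _ _) (Cdf i) x Ox.
have [r2 r20 Hr2] := iffLR (continuous_epsP _ _) ci _ (divr_gt0 eps0 c0).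
pose r := Num.min r1 r2.
have r0 : 0 < r by rewrite lt_min r10.
have wc0 : 0 < `|c| + `|w| + 1 by rewrite ltr_pwDr // addr_ge0.
near=> h; rewrite subr0 /e mul0r !scale0r !add0r subrr subr0.
have hr : `|h| * (`|c| + `|w| + 1) < r.
  rewrite -ltr_pdivlMr // -[h]subr0 distrC; near: h.
  by have /cvgrPdist_lt := @cvg_id R (nbhs 0); apply; rewrite divr_gt0.
have close y : `|y - (h *: w + x)| <= `|h * c| -> `|y - x| < r.
  move=> Hy; apply: le_lt_trans hr.
  rewrite -[y](subrK (h *: w + x)) -addrA [h *: w + x - x]addrK.
  apply: le_trans (ler_normD _ _) _; rewrite normrZ.
  apply: (@le_trans _ _ (`|h| * `|c| + `|h| * `|w|)); last first.
    by rewrite -mulrDr ler_wpM2l // lerDl.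
  by rewrite lerD // -normrM.
have [|y Hy ->] := @line_MVT _ _ O f i (h *: w + x) (h * c) Cf.
  by move=> y /close Hy; apply: Hr1; apply: lt_le_trans Hy _; rewrite ge_min lexx.
have {}Hy : `|pd i f y - pd i f x| <= eps / (`|c| + 1).
  by apply: Hr2; apply: lt_le_trans (close _ Hy) _; rewrite ge_min lexx orbT.
rewrite (_ : _ - _ = h * (c * (pd i f y - pd i f x))); last by ring.
rewrite normrM [leRHS]mulrC ler_wpM2l // normrM.
apply: (@le_trans _ _ ((`|c| + 1) * (eps / (`|c| + 1)))); last first.
  by rewrite mulrC divfK // gt_eqF.
by rewrite ler_pM // lerDl.
Unshelve. all: by end_near. Qed.

(** The second difference is symmetric in [i] and [j], so exchanging them equates values of the two
    mixed derivatives at points near [x]; continuity then gives [pdC]. *)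
Lemma mixed_difference O f i j (x : V) (h : R) : C1on O f -> C1on O (pd i f) ->
  0 < h -> (forall y, `|y - x| <= 2 * h -> O y) ->
  exists2 p, `|p - x| <= 2 * h &
   f (h *: evec j + (h *: evec i + x)) - f (h *: evec i + x)
     - (f (h *: evec j + x) - f x) = h ^+ 2 * pd j (pd i f) p.
Proof.
move=> Cf Cdf h0 Ox.
pose g (t : R) := f (t *: evec i + (h *: evec j + x)) - f (t *: evec i + x).
have nb (t : R) k : `|t| <= h -> `|t *: evec k : V| <= h.
  by move=> th; apply: le_trans (norm_scale_evec _ _) th.
have O1 (t : R) : `|t| <= h -> O (t *: evec i + x).
  by move=> th; apply: Ox; rewrite addrK; apply: le_trans (nb _ _ th) _; lra.
have hh : `|h| <= h by rewrite gtr0_norm.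
have O2 (t : R) : `|t| <= h -> O (t *: evec i + (h *: evec j + x)).
  move=> th; apply: Ox; rewrite addrA addrK; apply: le_trans (ler_normD _ _) _.
  by have := nb _ i th; have := nb _ j hh; lra.
have dg (t : R) : `|t| <= h -> is_derive t (1 : R) g
    (pd i f (t *: evec i + (h *: evec j + x)) - pd i f (t *: evec i + x)).
  move=> th; apply: is_deriveB; apply: is_derive_along.
    exact: C1on_is_derive Cf (O2 _ th).
  exact: C1on_is_derive Cf (O1 _ th).
have [||t th E] := MVT_segment (ltW h0) (f := g) (df := fun t : R =>
   pd i f (t *: evec i + (h *: evec j + x)) - pd i f (t *: evec i + x)).
- by move=> t; rewrite in_itv /= => /andP[t0 th]; apply: dg; rewrite gtr0_norm // ltW.
- apply: derivable_within_continuous => t; rewrite in_itv /= => /andP[t0 th].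
  by have [] := dg t; rewrite ?ger0_norm.
have {}th : `|t| <= h by move: th; rewrite in_itv /= => /andP[t0 th]; rewrite ger0_norm.
have [|p Hp E2] := @line_MVT _ _ O (pd i f) j (t *: evec i + x) h Cdf.
  move=> y Hy; apply: Ox; rewrite -[y](subrK (t *: evec i + x)) -addrA addrK.
  apply: le_trans (ler_normD _ _) _.
  by have := nb _ i th; move: Hy; rewrite (gtr0_norm h0); lra.
exists p.
  rewrite -[p](subrK (t *: evec i + x)) -addrA addrK.
  apply: le_trans (ler_normD _ _) _.
  by have := nb _ i th; move: Hp; rewrite (gtr0_norm h0); lra.
move: E; rewrite /g subr0 scale0r !add0r => E.
have -> : f (h *: evec j + (h *: evec i + x)) - f (h *: evec i + x) - (f (h *: evec j + x) - f x)
  = (pd i f (t *: evec i + (h *: evec j + x)) - pd i f (t *: evec i + x)) * h.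
  by rewrite -E [h *: evec j + (_ + _)]addrCA.
by rewrite addrCA E2 expr2; ring.
Qed.

Lemma pdC O f i j x : open O -> smooth O f -> O x -> pd j (pd i f) x = pd i (pd j f) x.
Proof.
move=> oO sf Ox.
have [ci _] := iffLR (C1onP _ _) (smooth_C1 [:: j; i] sf) x Ox.
have [cj _] := iffLR (C1onP _ _) (smooth_C1 [:: i; j] sf) x Ox.
have [r0 r00 Hr0] := open_ball_sub oO Ox.
apply/eqP; rewrite -subr_eq0 -normr_le0; apply/ler_addgt0Pl => eps eps0; rewrite addr0.
have e2 : 0 < eps / 2 by lra.
have [r1 r10 Hr1] := iffLR (continuous_epsP _ _) ci _ e2; have [r2 r20 Hr2] := iffLR (continuous_epsP _ _) cj _ e2.
pose h := Num.min r0 (Num.min r1 r2) / 3.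
have m0 : 0 < Num.min r0 (Num.min r1 r2) by rewrite !lt_min r00 r10.
have h0 : 0 < h by rewrite /h; lra.
have m3 : Num.min r0 (Num.min r1 r2) = 3 * h by rewrite /h; lra.
have hr0 : 2 * h < r0.
  by apply: (@lt_le_trans _ _ (3 * h)); [lra|rewrite -m3 ge_min lexx].
have hr1 : 2 * h < r1.
  by apply: (@lt_le_trans _ _ (3 * h)); [lra|rewrite -m3 !ge_min lexx !orbT].
have hr2 : 2 * h < r2.
  by apply: (@lt_le_trans _ _ (3 * h)); [lra|rewrite -m3 !ge_min lexx !orbT].
have Oy y : `|y - x| <= 2 * h -> O y by move=> Hy; apply: Hr0; apply: le_lt_trans Hy _.
have Cf := smooth_C1 [::] sf.
have [p Hp E1] := mixed_difference j Cf (smooth_C1 [:: i] sf) h0 Oy.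
have [q Hq E2] := mixed_difference i Cf (smooth_C1 [:: j] sf) h0 Oy.
have E : pd j (pd i f) p = pd i (pd j f) q.
  have h2 : h ^+ 2 != 0 by rewrite expf_neq0 // gt_eqF.
  apply: (mulfI h2); rewrite -E1 -E2 [h *: evec j + (_ + _)]addrCA.
  move: (f (h *: evec i + (h *: evec j + x))) (f (h *: evec i + x)) (f (h *: evec j + x)) => *; ring.
have B1 := Hr1 p (le_lt_trans Hp hr1); have B2 := Hr2 q (le_lt_trans Hq hr2).
move: B1 B2; rewrite /= E; move: (pd i (pd j f) q) => z B1 B2.
rewrite (_ : _ - _ = (z - pd i (pd j f) x) - (z - pd j (pd i f) x)); last by ring.
by apply: le_trans (ler_normB _ _) _; lra.
Qed.

Lemma ipd_catC O f s t i x : open O -> smooth O f -> O x ->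
  ipd (s ++ i :: t) f x = ipd (i :: s ++ t) f x.
Proof.
move=> oO sf; elim: s x => // j s IH x Ox /=.
rewrite (eq_on_pd j oO IH Ox) /=; apply: pdC oO _ Ox.
exact: smooth_iter.
Qed.

Lemma ipd_perm O f s t x : open O -> smooth O f -> O x -> perm_eq s t ->
  ipd s f x = ipd t f x.
Proof.
move=> oO sf; elim: s t x => [|i s IH] t x Ox st.
  by move: st; rewrite perm_sym => /perm_nilP->.
have it : i \in t by rewrite -(perm_mem st) mem_head.
case/splitPr: it st => t1 t2 st.
rewrite (ipd_catC _ _ _ oO sf Ox) /=; apply: (eq_on_pd i oO _ Ox) => y Oy.
apply: IH => //; rewrite -(perm_cons i); apply: perm_trans st _.
by rewrite -[i :: t2]cat1s perm_catCA.
Qed.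

(** Estimates are carried out on words of indices, where an induction strips one derivative at a
    time; this word translates a multi-index. *)
Definition multi_seq (J : 'I_n -> nat) : seq 'I_n :=
  flatten [seq nseq (J i) i | i <- enum 'I_n].

Lemma DmiE (J : 'I_n -> nat) f : Dmi J f = ipd (multi_seq J) f.
Proof.
rewrite /Dmi /multi_seq; elim: (enum 'I_n) => //= i l ->.
by rewrite ipd_cat; elim: (J i) => //= k ->; rewrite pdE.
Qed.

Lemma size_multi_seq (J : 'I_n -> nat) : size (multi_seq J) = mdeg J.
Proof.
rewrite size_flatten /shape -map_comp sumnE big_map big_enum /=.
by apply: eq_bigr => i _; rewrite size_nseq.
Qed.

Lemma perm_multi_seq s : perm_eq s (multi_seq (fun i => count_mem i s)).
Proof.
apply/allP => i _ /=; apply/eqP.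
rewrite count_flatten -map_comp sumnE big_map big_enum /= (bigD1 i) //=.
rewrite count_nseq /= eqxx mul1n big1 ?addn0 // => j ji.
by rewrite count_nseq /= (negbTE ji).
Qed.

Lemma mdeg_count s : mdeg (fun i => count_mem i s) = size s.
Proof. by rewrite -size_multi_seq (perm_size (perm_multi_seq s)). Qed.

Lemma ipd_Dmi O f s x : open O -> smooth O f -> O x ->
  ipd s f x = Dmi (fun i => count_mem i s) f x.
Proof. by move=> oO sf Ox; rewrite DmiE; apply: ipd_perm oO sf Ox (perm_multi_seq s). Qed.

Lemma flat_ipd O f s a : open O -> smooth O f -> O a -> flat_at f a -> ipd s f a = 0.
Proof. by move=> oO sf Oa fl; rewrite (ipd_Dmi _ oO sf Oa) fl. Qed.

Lemma ipd_flat f a : (forall s, ipd s f a = 0) -> flat_at f a.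
Proof. by move=> H J; rewrite DmiE. Qed.

(** As the bounds depend only on the length of a word, the Leibniz sum over subwords collapses to
    the one-variable binomial sum, and Pascal's rule gives the induction. *)
Lemma ipdM_le O f g s x (F G : nat -> R) : open O -> smooth O f -> smooth O g -> O x ->
  (forall t, `|ipd t f x| <= F (size t)) -> (forall t, `|ipd t g x| <= G (size t)) ->
  `|ipd s (fun y => f y * g y) x| <=
    \sum_(k < (size s).+1) 'C(size s, k)%:R * (F k * G (size s - k)%N).
Proof.
move=> oO + + Ox; elim/last_ind: s f g F G => [|s i IH] f g F G sf sg HF HG.
  rewrite big_ord1 bin0 mul1r /= normrM ler_pM //; first exact: (HF [::]).
  exact: (HG [::]).
have sdf := smooth_pd i sf; have sdg := smooth_pd i sg.
have E : forall y, O y -> pd i (fun y => f y * g y) y = pd i f y * g y + f y * pd i g y.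
  by move=> y Oy; apply: (pdM _ (smooth_C1 [::] sf) (smooth_C1 [::] sg) Oy).
have H1 := IH _ _ (fun k => F k.+1) G sdf sg _ HG.
have H2 := IH _ _ F (fun k => G k.+1) sf sdg HF _.
rewrite -cats1 ipd_cat (eq_on_iter s oO E Ox) (ipdD _ oO (smoothM oO sdf sg) (smoothM oO sf sdg) Ox).
apply: le_trans (ler_normD _ _) _; apply: le_trans (lerD (H1 _) (H2 _)) _.
- by move=> t; have := HF (rcons t i); rewrite -cats1 ipd_cat size_cat addn1.
- by move=> t; have := HG (rcons t i); rewrite -cats1 ipd_cat size_cat addn1.
rewrite size_cat addn1; set m := size s.
rewrite [leRHS]big_ord_recl /= bin0 subn0.
rewrite [X in _ <= _ + X](eq_bigr (fun k : 'I_m.+1 => 'C(m, k.+1)%:R * (F k.+1 * G (m - k)%N)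
   + 'C(m, k)%:R * (F k.+1 * G (m - k)%N))); last first.
  by move=> k _; rewrite /bump /= add1n binS natrD mulrDl subSS.
rewrite big_split /= addrA [leRHS]addrC lerD2l.
rewrite big_ord_recl /= bin0 subn0 lerD2l.
rewrite [leRHS]big_ord_recr /= bin_small // mul0r addr0.
rewrite le_eqVlt; apply/orP; left; apply/eqP; apply: eq_bigr => k _.
by rewrite /bump /= add1n -subSn.
Qed.

(** Both g and -g are compared with the primitive of [C * t ^+ k]: the difference has nonnegative
    derivative and vanishes at 0. *)
Lemma power_bound_primitive (g g' : R -> R) (C : R) (k : nat) : g 0 = 0 ->
  (forall t : R, 0 <= t <= 1 -> is_derive t (1 : R) g (g' t)) ->
  (forall t : R, 0 <= t <= 1 -> `|g' t| <= C * t ^+ k) ->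
  forall t : R, 0 <= t <= 1 -> `|g t| <= C / k.+1%:R * t ^+ k.+1.
Proof.
move=> g0 dg Hg' t /andP[t0 t1].
have main (e : R) : `|e| = 1 -> e * g t <= C / k.+1%:R * t ^+ k.+1.
  move=> e1; pose psi (u : R) := C / k.+1%:R * u ^+ k.+1 - e * g u.
  have dpsi (u : R) : 0 <= u <= 1 -> is_derive u (1 : R) psi (C * u ^+ k - e * g' u).
    move=> u01.
    have D1 := is_deriveZ e (dg u u01).
    have D2 := is_deriveZ (C / k.+1%:R) (is_deriveX k.+1 (is_derive_id u (1 : R))).
    have := is_deriveB D2 D1.
    rewrite -![_ *: _]/(_ * _) mulr1 /= => D; apply: is_derive_eq.
      rewrite (_ : psi = (C / k.+1%:R) \*: (id ^+ k.+1) - e \*: g); first exact: D.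
      by apply/funext => w; rewrite /psi -[RHS]/((C / k.+1%:R) * (id ^+ k.+1) w - e * g w) fctE.
    by congr (_ - _); rewrite mulrA divfK // pnatr_eq0.
  have [||c Hc E] := MVT_segment t0 (f := psi) (df := fun u => C * u ^+ k - e * g' u).
  - move=> u; rewrite in_itv /= => /andP[u0 ut]; apply: dpsi.
    by rewrite (ltW u0) (le_trans (ltW ut)).
  - apply: derivable_within_continuous => u; rewrite in_itv /= => /andP[u0 ut].
    by have [] := dpsi u; rewrite ?u0 ?(le_trans ut).
  have c01 : 0 <= c <= 1 by move: Hc; rewrite in_itv /= => /andP[-> /le_trans->].
  move: E; rewrite subr0 /psi g0 expr0n /= !mulr0 !subr0 => E.
  rewrite -subr_ge0 E mulr_ge0 // subr_ge0; apply: le_trans (ler_norm _) _.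
  by rewrite normrM e1 mul1r Hg'.
have := main 1 (normr1 _); have := main (-1) (normrN1 _); rewrite mulN1r mul1r.
by move: (_ * t ^+ _) => z H1 H2; rewrite ler_norml; apply/andP; split; lra.
Qed.

Lemma flat_taylor O f a v (B : R) k s : open O -> smooth O f ->
  (forall t : R, 0 <= t <= 1 -> O (t *: v + a)) ->
  (forall s', ipd s' f a = 0) ->
  (forall s' (t : R), 0 <= t <= 1 -> size s' = (k + size s)%N -> `|ipd s' f (t *: v + a)| <= B) ->
  forall t : R, 0 <= t <= 1 ->
    `|ipd s f (t *: v + a)| <= (\sum_i `|v ord0 i|) ^+ k / k`!%:R * B * t ^+ k.
Proof.
move=> oO sf Ov fl; elim: k s => [|k IH] s HB t t01.
  by rewrite !expr0 divr1 mul1r mulr1; apply: HB.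
set L := \sum_i _ in IH *.
have -> : L ^+ k.+1 / (k.+1)`!%:R * B * t ^+ k.+1 =
   (L * (L ^+ k / k`!%:R * B)) / k.+1%:R * t ^+ k.+1.
  rewrite factS natrM exprS invfM; ring.
apply: (@power_bound_primitive (fun u => ipd s f (u *: v + a))
  (fun u => \sum_i v ord0 i * pd i (ipd s f) (u *: v + a))) => //.
- by rewrite scale0r add0r fl.
- move=> u u01; apply: is_derive_along.
  apply: (C1on_is_derive_dir _ oO (Ov _ u01)); first exact: smooth_C1.
  by move=> i; apply: (smooth_C1 (i :: s)).
- move=> u u01; apply: le_trans (ler_norm_sum _ _ _) _.
  rewrite /L -!mulrA mulr_suml ler_sum // => i _; rewrite normrM ler_wpM2l // mulrA mulrA.
  apply: (IH (i :: s)) => // s' t' t'01 Hs'; apply: HB => //.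
  by rewrite Hs' /= addnS.
Qed.

Lemma sum_norm_le (v : V) : \sum_i `|v ord0 i| <= n%:R * `|v|.
Proof.
rewrite -[n in n%:R]card_ord -sum1_card natr_sum mulr_suml ler_sum // => i _.
by rewrite mul1r entry_norm_le.
Qed.

End Calculus.

(** * The classes C_M *)

Section ClassBounds.
Context {R : realType} (M : nat -> R).
Hypothesis HM : strongly_regular M.

Definition cmb (C sg : R) (k : nat) : R := C * sg ^+ k * k`!%:R * M k.

Lemma cmb_ge0 C sg k : 0 <= C -> 0 <= sg -> 0 <= cmb C sg k.
Proof. by move=> C0 s0; rewrite /cmb !mulr_ge0 ?exprn_ge0 ?(weight_ge0 HM). Qed.

Lemma cmb_homo C C' sg sg' k : 0 <= C -> 0 <= sg -> C <= C' -> sg <= sg' ->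
  cmb C sg k <= cmb C' sg' k.
Proof.
move=> C0 s0 CC ss; rewrite /cmb !ler_wpM2r ?(weight_ge0 HM) ?ler0n //.
by apply: ler_pM; rewrite ?exprn_ge0 // lerXn2r // nnegrE (le_trans s0).
Qed.

Lemma cmbZ a C sg k : a * cmb C sg k = cmb (a * C) sg k.
Proof. by rewrite /cmb !mulrA. Qed.

(** The binomial coefficient completes the two factorials to j!, log-convexity gives M_k M_(j-k) <=
    M_j, and the j+1 equal terms are absorbed by 2^j. *)
Lemma cmb_leibniz C1 C2 sg j : 0 <= C1 -> 0 <= C2 -> 0 <= sg ->
  \sum_(k < j.+1) 'C(j, k)%:R * (cmb C1 sg k * cmb C2 sg (j - k)) <=
  cmb (C1 * C2) (2 * sg) j.
Proof.
move=> C10 C20 s0; pose T := C1 * C2 * sg ^+ j * j`!%:R * M j.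
have T0 : 0 <= T by rewrite /T !mulr_ge0 ?exprn_ge0 ?(weight_ge0 HM).
apply: (@le_trans _ _ (\sum_(k < j.+1) T)).
  apply: ler_sum => k _; have kj : (k <= j)%N by rewrite -ltnS.
  have -> : 'C(j, k)%:R * (cmb C1 sg k * cmb C2 sg (j - k)) =
     C1 * C2 * (sg ^+ k * sg ^+ (j - k)) * ('C(j, k)%:R * (k`!%:R * (j - k)`!%:R)) * (M k * M (j - k)%N).
    by rewrite /cmb; ring.
  rewrite -exprD subnKC // -!natrM bin_fact // /T.
  rewrite ler_wpM2l ?mulr_ge0 ?exprn_ge0 //.
  by have := weight_mul_le HM k (j - k); rewrite subnKC.
have -> : cmb (C1 * C2) (2 * sg) j = T * 2 ^+ j by rewrite /cmb /T exprMn; ring.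
rewrite sumr_const card_ord -[T *+ _]mulr_natr.
by rewrite ler_wpM2l // -natrX ler_nat ltn_expl.
Qed.

End ClassBounds.

Section ClassCalculus.
Context {R : realType} {n : nat} (M : nat -> R).
Hypothesis HM : strongly_regular M.
Local Notation V := 'rV[R]_n.
Local Notation cmb := (cmb M).
Implicit Types (f g h : V -> R) (O U X K : set V) (s t : seq 'I_n).

Lemma ipdM_cmb O f g C1 C2 sg x : open O -> smooth O f -> smooth O g -> O x ->
  0 <= C1 -> 0 <= C2 -> 0 <= sg ->
  (forall t, `|ipd t f x| <= cmb C1 sg (size t)) ->
  (forall t, `|ipd t g x| <= cmb C2 sg (size t)) ->
  forall s, `|ipd s (fun y => f y * g y) x| <= cmb (C1 * C2) (2 * sg) (size s).
Proof.
move=> oO sf sg' Ox C10 C20 s0 Hf Hg s.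
by apply: le_trans (ipdM_le s oO sf sg' Ox Hf Hg) _; apply: cmb_leibniz.
Qed.

Lemma ipd_prod_cmb O I (r : seq I) (F : I -> V -> R) C sg x : open O ->
  (forall k, smooth O (F k)) -> O x -> 0 <= C -> 0 <= sg ->
  (forall k t, `|ipd t (F k) x| <= cmb C sg (size t)) ->
  forall s, `|ipd s (fun y => \prod_(k <- r) F k y) x| <=
    cmb (C ^+ size r) (2 ^+ size r * sg) (size s).
Proof.
move=> oO sF Ox C0 s0 HF; elim: r => [|k r IH] s.
  rewrite (eq_on_iter (g := fun=> 1) s oO _ Ox); last by move=> y _; rewrite big_nil.
  have [->|s1] := eqVneq s [::].
    by rewrite /= normr1 /cmb !expr0 !mul1r (weight_ge1 HM).
  by rewrite ipd_cst // normr0; apply: cmb_ge0; rewrite // mulr_ge0.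
rewrite (eq_on_iter (g := fun y => F k y * \prod_(j <- r) F j y) s oO _ Ox); last first.
  by move=> y _; rewrite big_cons.
have p0 : 0 <= 2 ^+ size r * sg :> R by rewrite mulr_ge0 ?exprn_ge0.
rewrite /= !exprS -mulrA; apply: (@ipdM_cmb O) => //.
- exact: smooth_prod.
- exact: exprn_ge0.
move=> t; apply: le_trans (HF k t) _; apply: cmb_homo => //.
by rewrite ler_peMl // exprn_ege1 // ler1n.
Qed.

Lemma compact_uniform_bound K (P : R -> V -> Prop) : compact K ->
  (forall c c' x, c <= c' -> P c x -> P c' x) ->
  (forall x0, K x0 -> exists2 r : R, 0 < r & exists c, forall x, `|x - x0| < r -> P c x) ->
  exists2 c : R, 0 < c & forall x, K x -> P c x.
Proof.
move=> /compact_near_coveringP cK mono loc.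
have H : \forall N \near \oo, forall x, K x -> P N%:R x.
  apply: (cK nat \oo (fun (N : nat) x => P N%:R x)) => x0 /loc[r r0 [c Hc]].
  exists ([set y | `|y - x0| < r], [set N : nat | c <= N%:R]) => /=.
    split; first by apply/near_norm; exists r.
    exact: nbhs_infty_ger.
  by move=> [y N] /= [yr cN]; apply: mono cN (Hc y yr).
have [N _ HN] := H.
exists N.+1%:R; first by rewrite ltr0n.
by move=> x Kx; apply: (HN N.+1) => //=.
Qed.

Lemma compact_closed_ball (x0 : V) (r : R) : compact [set x : V | `|x - x0| <= r].
Proof.
apply: bounded_closed_compact.
  exists (`|x0| + r); split=> [|B HB x /= xr]; first exact: num_real.
  rewrite -[x](subrK x0); apply: le_trans (ler_normD _ _) _.
  by apply: ltW; apply: le_lt_trans HB; rewrite addrC lerD2l.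
rewrite (_ : mkset _ = (fun x : V => `|x - x0|) @^-1` [set y : R | y <= r]) //.
apply: closed_comp; last exact: closed_le.
move=> x _; apply: continuous_comp; last exact: norm_continuous.
by apply: continuousB => //; exact: cst_continuous.
Qed.

Lemma inCM_smooth O f : inCM M O f -> smooth O f.
Proof. by move=> [/smoothP]. Qed.

Lemma inCM_ball O f (x0 : V) (r : R) : open O -> inCM M O f ->
  (forall x, `|x - x0| <= r -> O x) ->
  exists C sg : R, [/\ 0 < C, 0 < sg &
    forall x, `|x - x0| <= r -> forall s, `|ipd s f x| <= cmb C sg (size s)].
Proof.
move=> oO fM Or; have sf := inCM_smooth fM; case: fM => _ H.
have [C [sg [C0 s0 HC]]] := H _ (compact_closed_ball (r := r) (x0 := x0)) Or.
exists C, sg; split=> // x xr s.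
have := HC (fun i => count_mem i s) x xr.
by rewrite mdeg_count -(ipd_Dmi s oO sf (Or _ xr)).
Qed.

Lemma inCM_local O f : smooth O f ->
  (forall x0, O x0 -> exists2 r : R, 0 < r & exists C sg : R, [/\ 0 <= C, 0 <= sg &
    forall x, O x -> `|x - x0| < r -> forall s, `|ipd s f x| <= cmb C sg (size s)]) ->
  inCM M O f.
Proof.
move=> sf loc; split; first exact/smoothP.
move=> K cK KO.
(* One number plays both constants, so that the bound is monotone in a single parameter. *)
pose P (c : R) (x : V) := 0 <= c /\ (O x -> forall s, `|ipd s f x| <= cmb c c (size s)).
have [||c c0 Hc] := @compact_uniform_bound K P cK.
- move=> c c' x cc [c0 H]; split; first exact: le_trans cc.
  by move=> Ox s; apply: le_trans (H Ox s) _; apply: cmb_homo.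
- move=> x0 /KO/loc[r r0 [C [sg [C0 s0 H]]]]; exists r => //; exists (C + sg).
  move=> x xr; split; first exact: addr_ge0.
  move=> Ox s; apply: le_trans (H x Ox xr s) _.
  by apply: cmb_homo; rewrite // ?lerDl ?lerDr.
exists c, c; split=> // J x Kx; rewrite DmiE -size_multi_seq.
by have [_] := Hc x Kx; apply; apply: KO.
Qed.

Lemma inCM_bounded O f C sg : open O -> smooth O f -> 0 <= C -> 0 <= sg ->
  (forall x s, O x -> `|ipd s f x| <= cmb C sg (size s)) -> inCM M O f.
Proof.
move=> oO sf C0 s0 H; apply: inCM_local => // x0 Ox0; exists 1 => //.
by exists C, sg; split=> // x Ox _ s; apply: H.
Qed.

End ClassCalculus.

(** * Smooth extension by zero *)

Section Gluing.
Context {R : realType} {n : nat}.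
Local Notation V := 'rV[R]_n.
Implicit Types (w : V -> R) (O X : set V) (s : seq 'I_n).

Definition zero_extension X w : V -> R := fun x => if `[< X x >] then 0 else w x.

Lemma zero_extension_in X w x : X x -> zero_extension X w x = 0.
Proof. by move=> Xx; rewrite /zero_extension asboolT. Qed.

Lemma zero_extension_out X w x : ~ X x -> zero_extension X w x = w x.
Proof. by move=> Xx; rewrite /zero_extension asboolF. Qed.

(** Quadratic decay makes each extended derivative continuous with zero partial derivatives at the
    points of [X], so the extended derivatives form a family closed under differentiation. *)
Lemma smooth_zero_extension O X w : open O -> open (O `\` X) -> smooth (O `\` X) w ->
  (forall s a, O a -> X a -> exists2 r : R, 0 < r & exists C : R,
     forall x, O x -> ~ X x -> `|x - a| < r -> `|ipd s w x| <= C * `|x - a| ^+ 2) ->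
  smooth O (zero_extension X w) /\
  forall s x, O x -> ipd s (zero_extension X w) x = zero_extension X (ipd s w) x.
Proof.
move=> oO oU sw quad; set W := fun s => zero_extension X (ipd s w).
have Wout s y : (O `\` X) y -> ipd s w y = W s y.
  by move=> [_ nX]; rewrite /W zero_extension_out.
have Wq s a : O a -> X a -> exists2 r : R, 0 < r & exists2 C : R, 0 <= C &
     forall x, `|x - a| < r -> `|W s x| <= C * `|x - a| ^+ 2.
  move=> Oa Xa; have [r r0 [C H]] := quad s a Oa Xa.
  have [r' r'0 Hr'] := open_ball_sub oO Oa.
  exists (Num.min r r'); first by rewrite lt_min r0.
  exists `|C| => // x; rewrite lt_min => /andP[xr xr'].
  have [Xx|nX] := pselect (X x).
    by rewrite /W zero_extension_in // normr0 mulr_ge0 ?sqr_ge0.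
  rewrite /W zero_extension_out //; apply: le_trans (H x (Hr' _ xr') nX xr) _.
  by rewrite ler_wpM2r ?sqr_ge0 // ler_norm.
have Wd s i a : O a -> X a -> is_derive a (evec i) (W s) 0.
  move=> Oa Xa; have [r r0 [C C0 H]] := Wq s a Oa Xa.
  apply/is_derive_line; apply: (@is_derive_quadratic _ _ _ _ C).
  near=> h; rewrite scale0r add0r subr0 mulr0 !subr0 /W (zero_extension_in _ Xa) subr0.
  have hr : `|h| < r.
    by rewrite -[h]subr0 distrC; near: h; have /cvgrPdist_lt := @cvg_id R (nbhs 0); apply.
  have nh : `|h *: evec i : V| <= `|h| := norm_scale_evec h i.
  have := H (h *: evec i + a); rewrite addrK => /(_ (le_lt_trans nh hr)) B.
  apply: le_trans B _; rewrite ler_wpM2l // -[h ^+ 2]real_normK ?num_real //.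
  by rewrite lerXn2r ?nnegrE.
have CW s : C1on O (W s).
  apply/C1onP => x Ox; have [Xx|nX] := pselect (X x).
    split=> [|i]; last by have [] := Wd s i x Ox Xx.
    have [r r0 [C C0 H]] := Wq s x Ox Xx.
    apply/continuous_epsP => eps eps0.
    exists (Num.min r (Num.min 1 (eps / (C + 1)))).
      by rewrite !lt_min r0 ltr01 divr_gt0 // ltr_wpDl.
    move=> y; rewrite !lt_min => /andP[yr /andP[y1 ye]].
    rewrite {2}/W zero_extension_in // subr0; apply: le_trans (H y yr) _.
    apply: (@le_trans _ _ ((C + 1) * `|y - x|)).
      by rewrite ler_pM ?sqr_ge0 ?lerDl // expr2 ler_piMl // ltW.
    by rewrite -ler_pdivlMl ?ltr_wpDl // mulrC ltW.
  have := C1on_eq oU (Wout s) (smooth_C1 s sw); move/C1onP; exact.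
have pW s i x : O x -> pd i (W s) x = W (i :: s) x.
  move=> Ox; have [Xx|nX] := pselect (X x).
    by rewrite (pd_is_derive (Wd s i x Ox Xx)) /W zero_extension_in.
  by rewrite -(eq_on_pd i oU (Wout s)) // /W zero_extension_out.
split=> [|s].
  apply: (@smooth_coind _ _ O (fun f => exists s, f = W s)) => //; last by exists [::].
    by move=> _ [s ->]; apply: CW.
  move=> _ i [s ->]; exists (W (i :: s)); first by exists (i :: s).
  exact: pW.
elim: s => // i s IH x Ox; rewrite /= (eq_on_pd i oO IH Ox); exact: pW.
Unshelve. all: by end_near. Qed.

End Gluing.

(** * Series with dyadic weights *)

Section DyadicSum.
Context {R : realType}.
Implicit Types (c d : nat -> R) (a B : R).

(** The exponent [p.+1] makes the weights sum to 1, so a bound common to all terms passes to the sum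
    with the same constant. *)
Definition dyadic_sum c : R := limn (series (fun p => (2^-1 : R) ^+ p.+1 * c p)).

Let series_half N : series (fun p => (2^-1 : R) ^+ p.+1) N = 1 - (2^-1) ^+ N.
Proof.
rewrite /series /=; elim: N => [|N IH]; first by rewrite big_geq // expr0 subrr.
by rewrite big_nat_recr //= IH exprS; lra.
Qed.

Lemma dyadic_partial_le c B : (forall p, `|c p| <= B) ->
  forall N, series (fun p => `|(2^-1 : R) ^+ p.+1 * c p|) N <= B.
Proof.
move=> cB N; have B0 : 0 <= B := le_trans (normr_ge0 _) (cB 0%N).
have h0 p : 0 <= (2^-1 : R) ^+ p by rewrite exprn_ge0 // invr_ge0.
apply: (@le_trans _ _ (series (fun p => (2^-1 : R) ^+ p.+1) N * B)).
  rewrite /series /= mulr_suml ler_sum // => p _.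
  by rewrite normrM (ger0_norm (h0 _)) ler_wpM2l.
by rewrite series_half -[leRHS]mul1r ler_wpM2r // gerBl.
Qed.

Lemma dyadic_cvg c B : (forall p, `|c p| <= B) ->
  series (fun p => (2^-1 : R) ^+ p.+1 * c p) @ \oo --> dyadic_sum c.
Proof.
move=> cB; apply: normed_cvg; rewrite /normed_series_of /=.
apply: nondecreasing_is_cvgn.
  by apply: nondecreasing_series => p _ _; apply: normr_ge0.
by exists B => _ [N _ <-]; apply: dyadic_partial_le.
Qed.

Lemma dyadic_sum_le c B : (forall p, `|c p| <= B) -> `|dyadic_sum c| <= B.
Proof.
move=> cB.
have cv : `|series (fun p => (2^-1 : R) ^+ p.+1 * c p) N| @[N --> \oo] --> `|dyadic_sum c|.
  by apply: cvg_norm; exact: dyadic_cvg cB.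
rewrite -(cvg_lim _ cv) //; apply: limr_le; first exact: cvgP cv.
near=> N; apply: le_trans (ler_norm_sum _ _ _) _; exact: dyadic_partial_le.
Unshelve. all: by end_near. Qed.

Lemma dyadic_sum_lin a c d B B1 : (forall p, `|c p| <= B) -> (forall p, `|d p| <= B1) ->
  dyadic_sum (fun p => c p + a * d p) = dyadic_sum c + a * dyadic_sum d.
Proof.
move=> cB dB; apply: cvg_lim => //.
rewrite (_ : series _ = (fun N => series (fun p => (2^-1 : R) ^+ p.+1 * c p) N +
   a * series (fun p => (2^-1 : R) ^+ p.+1 * d p) N)).
  by apply: cvgD; [exact: dyadic_cvg cB|apply: cvgMr; exact: dyadic_cvg dB].
apply/funext => N; rewrite /series /= mulr_sumr -big_split /=.
by apply: eq_bigr => p _; ring.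
Qed.

Lemma dyadic_sum_single c q : (forall p, p != q -> c p = 0) ->
  dyadic_sum c = (2^-1) ^+ q.+1 * c q.
Proof.
move=> c0; apply: cvg_lim => //; apply: cvg_near_cst; near=> N.
have qN : (q < N)%N by near: N; exists q.+1.
rewrite /series /= (bigD1_seq q) ?mem_index_iota ?iota_uniq //= big1 ?addr0 //.
by move=> p pq; rewrite c0 // mulr0.
Unshelve. all: by end_near. Qed.

End DyadicSum.

Section SmoothSeries.
Context {R : realType} {n : nat}.
Local Notation V := 'rV[R]_n.
Implicit Types (f : V -> R) (s : seq 'I_n).

Lemma smooth_lipschitz f B : smooth setT f -> (forall i x, `|pd i f x| <= B) ->
  forall x y, `|f y - f x| <= n%:R * B * `|y - x|.
Proof.
move=> sf fB x y; pose g (t : R) := f (t *: (y - x) + x).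
have Hg : has_deriv g (fun t => \sum_i (y - x) ord0 i * pd i f (t *: (y - x) + x)).
  move=> t; apply: is_derive_along.
  apply: (@C1on_is_derive_dir _ _ setT) => //; first exact: openT.
    exact: (smooth_C1 [::] sf).
  by move=> i; apply: (smooth_C1 [:: i] sf).
have [c _] := has_deriv_MVT Hg ltr01.
rewrite /g scale1r subrK scale0r add0r subr0 mulr1 => ->.
apply: le_trans (ler_norm_sum _ _ _) _.
rewrite -[n in n%:R]card_ord -sum1_card natr_sum !mulr_suml ler_sum // => i _.
by rewrite mul1r normrM mulrC ler_pM // entry_norm_le.
Qed.

Lemma smooth_taylor2 f i C : smooth setT f -> (forall x, `|pd i (pd i f) x| <= C) ->
  forall x (h : R), `|f (h *: evec i + x) - f x - h * pd i f x| <= C * h ^+ 2.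
Proof.
move=> sf fC x h.
have H g : smooth setT g -> has_deriv (fun t : R => g (t *: evec i + x))
    (fun t => pd i g (t *: evec i + x)).
  move=> sg t; apply: is_derive_along.
  exact: (C1on_is_derive _ (smooth_C1 [::] sg)).
have := has_deriv_taylor2 (H f sf) (H _ (smooth_pd i sf)) (fun t => fC _) 0 h.
by rewrite scale0r add0r subr0.
Qed.

(** Second-order Taylor bounds uniform in [p] add up to a quadratic remainder for the sum, which
    gives termwise differentiation; Lipschitz bounds give continuity. *)
Lemma smooth_dyadic_sum (f : nat -> V -> R) (B : nat -> R) :
  (forall p, smooth setT (f p)) ->
  (forall p s x, `|ipd s (f p) x| <= B (size s)) ->
  smooth setT (fun x => dyadic_sum (fun p => f p x)) /\
  forall s x, ipd s (fun x => dyadic_sum (fun p => f p x)) x =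
    dyadic_sum (fun p => ipd s (f p) x).
Proof.
move=> sf fB; set S := fun s x => dyadic_sum (fun p => ipd s (f p) x).
have Sd s i x : is_derive x (evec i) (S s) (S (i :: s) x).
  apply/is_derive_line; apply: (@is_derive_quadratic _ _ _ _ (B (size s).+2)).
  near=> h; rewrite scale0r add0r subr0.
  rewrite /S -mulNr -[- dyadic_sum _]mulN1r.
  rewrite -(dyadic_sum_lin _ (fun p => fB p s _) (fun p => fB p s _)).
  have b p : `|ipd s (f p) (h *: evec i + x) + -1 * ipd s (f p) x| <= B (size s) + B (size s).
    by rewrite mulN1r; apply: le_trans (ler_normB _ _) _; rewrite lerD.
  rewrite -(dyadic_sum_lin _ b (fun p => fB p (i :: s) x)).
  apply: dyadic_sum_le => p; rewrite mulN1r mulNr.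
  apply: smooth_taylor2; first exact: smooth_iter.
  by move=> y; apply: (fB p (i :: i :: s)).
have CS s : C1on setT (S s).
  apply/C1onP => x _; split=> [|i]; last by have [] := Sd s i x.
  have lip y : `|S s y - S s x| <= n%:R * B (size s).+1 * `|y - x|.
    rewrite /S -[- dyadic_sum _]mulN1r.
    rewrite -(dyadic_sum_lin _ (fun p => fB p s _) (fun p => fB p s _)).
    apply: dyadic_sum_le => p; rewrite mulN1r; apply: smooth_lipschitz.
      exact: smooth_iter.
    by move=> i z; apply: (fB p (i :: s)).
  apply/continuous_epsP => eps eps0.
  have L0 : 0 < `|n%:R * B (size s).+1| + 1 by rewrite ltr_wpDl.
  exists (eps / (`|n%:R * B (size s).+1| + 1)); first exact: divr_gt0.
  move=> y ye; apply: le_trans (lip y) _.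
  apply: (@le_trans _ _ ((`|n%:R * B (size s).+1| + 1) * `|y - x|)).
    by rewrite ler_wpM2r // (le_trans (ler_norm _)) // lerDl.
  by rewrite -ler_pdivlMl // mulrC ltW.
split=> [|s].
  apply: (@smooth_coind _ _ setT (fun g => exists s, g = S s)); first exact: openT.
  - by move=> _ [s ->].
  - move=> _ i [s ->]; exists (S (i :: s)); first by exists (i :: s).
    by move=> x _; apply: pd_is_derive.
  - by exists [::].
elim: s => // i s IH x; rewrite /= (_ : ipd s _ = S s); last exact/funext.
exact: pd_is_derive.
Unshelve. all: by end_near. Qed.

End SmoothSeries.

(** * Bumps adapted to the weight sequence *)

Section Bump.
Context {R : realType} {n : nat} (M : nat -> R).
Hypothesis HM : strongly_regular M.
Local Notation V := 'rV[R]_n.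
Implicit Types (s : seq 'I_n).

(** Balls of the max norm are cubes, so a bump is a product of one-variable steps, one for each of
    the 2n faces. *)
Lemma adapted_bump (lam : R) : 0 < lam -> exists2 sg : R, 0 < sg &
  forall (r : R) (x0 : V), 0 < r -> exists chi : V -> R,
  [/\ smooth setT chi,
      forall y, r <= `|y - x0| -> chi y = 0,
      forall y, `|y - x0| <= r / 2 -> chi y = 1 &
      forall s y, hM M (lam * r) * `|ipd s chi y| <= cmb M 1 sg (size s)].
Proof.
move=> lam0; pose I := ('I_n * bool)%type; pose q := size (index_enum I).
have [B B0 HB] := hM_le_exp HM q.
(* Each step rises over a length [r / 2], hence the factor 2; [B] lets the [q]-th power of [hM] at
   [B * (lam * r)] dominate its value at [lam * r]. *)
have l1 : 0 < 2 * (B * lam) by rewrite !mulr_gt0.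
have [sg sg0 Hsg] := adapted_widths HM l1.
exists (2 ^+ q * sg); first by rewrite mulr_gt0 ?exprn_gt0.
move=> r x0 r0; have r20 : 0 < r / 2 by lra.
have [a [a0 aS aP]] := Hsg _ r20.
have [th [thd th0 th1 thB]] := smooth_step a0 aS.
have th_S : forall k, has_deriv (th k) (th k.+1) by [].
(* The argument of a step is the signed distance to a face, positive inside: 0 on the face, at least
   [r / 2] on the half-size cube. *)
pose c (k : I) : R := if k.2 then 1 else -1.
pose d (k : I) : R := if k.2 then r - x0 ord0 k.1 else r + x0 ord0 k.1.
pose F (k : I) (y : V) := th 0%N (c k * y ord0 k.1 + d k).
have sF k : smooth setT (F k) by apply: smooth_coord.
have lr0 : 0 < 2 * (B * lam) * (r / 2) by rewrite mulr_gt0.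
have h0 := hM_gt0 HM lr0.
have FB k t y : `|ipd t (F k) y| <= cmb M (hM M (2 * (B * lam) * (r / 2)))^-1 sg (size t).
  rewrite /F ipd_coord //; apply: (@le_trans _ _ `|th (size t) (c k * y ord0 k.1 + d k)|).
    rewrite !normrM normrX -[leRHS]mul1r ler_wpM2r //.
    have -> : `|c k| = 1 by rewrite /c; case: k.2; rewrite ?normrN normr1.
    by rewrite expr1n mul1r normr_nat lern1 leq_b1.
  apply: le_trans (thB _ _) _.
  set hr := hM M _ in h0 *.
  rewrite (_ : cmb M hr^-1 sg _ = sg ^+ size t * (size t)`!%:R * M (size t) / hr).
    by rewrite ler_pdivlMr //; apply: aP.
  by rewrite /cmb; ring.
exists (fun y => \prod_(k <- index_enum I) F k y); split.
- by apply: smooth_prod => //; exact: openT.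
- move=> y ry.
  suff [k Fk0] : exists k, F k y = 0 by rewrite (bigD1 k) //= Fk0 mul0r.
  have [i Hi] : exists i, r <= `|(y - x0) ord0 i|.
    apply: contrapT => /forallNP H.
    have : `|y - x0| < r by apply: rV_norm_lt => // i; rewrite ltNge; apply/negP/H.
    by rewrite ltNge ry.
  move: Hi; rewrite !mxE; case: (leP 0 (y ord0 i - x0 ord0 i)) => H.
    rewrite ger0_norm // => Hi; exists (i, false); rewrite /F /c /d /= th0 //; lra.
  rewrite ltr0_norm // => Hi; exists (i, true); rewrite /F /c /d /= th0 //; lra.
- move=> y yr; rewrite big1 // => k _; rewrite /F th1 //.
  have := le_trans (entry_norm_le _ k.1) yr; rewrite !mxE ler_norml => /andP[H1 H2].
  by rewrite /c /d; case: k.2; lra.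
- move=> s y.
  have lr : 0 < lam * r by rewrite mulr_gt0.
  have hi0 : 0 <= (hM M (2 * (B * lam) * (r / 2)))^-1 by rewrite invr_ge0 ltW.
  have := ipd_prod_cmb HM (index_enum I) openT sF (Logic.I : setT y) hi0 (ltW sg0) (fun k t => FB k t y) s.
  rewrite -/q => H.
  apply: (@le_trans _ _ (hM M (lam * r) * cmb M ((hM M (2 * (B * lam) * (r / 2)))^-1 ^+ q) (2 ^+ q * sg) (size s))).
    by rewrite ler_wpM2l // hM_ge0 // ltW.
  rewrite cmbZ; apply: cmb_homo => //.
  - by rewrite mulr_ge0 ?exprn_ge0 ?hM_ge0 // ltW.
  - by rewrite mulr_ge0 ?exprn_ge0 // ltW.
  - rewrite exprVn ler_pdivrMr ?exprn_gt0 // mul1r.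
    rewrite (_ : 2 * (B * lam) * (r / 2) = B * (lam * r)); last by field.
    exact: HB.
Qed.

End Bump.

(** * The Lojasiewicz condition *)

Section Distance.
Context {R : realType} {n : nat}.
Local Notation V := 'rV[R]_n.
Implicit Types (x y a : V) (X O : set V).

Lemma norm_le_eucl x : `|x| <= eucl x.
Proof.
apply: rV_norm_le => [|i]; first exact: sqrtr_ge0.
rewrite -sqrtr_sqr ler_wsqrtr // (bigD1 i) //= lerDl sumr_ge0 // => j _.
exact: sqr_ge0.
Qed.

Lemma eucl_le_norm x : eucl x <= n%:R * `|x|.
Proof.
rewrite -[leRHS]ger0_norm ?mulr_ge0 // -sqrtr_sqr ler_wsqrtr // exprMn.
apply: (@le_trans _ _ (n%:R * `|x| ^+ 2)).
  rewrite -[n in n%:R]card_ord -sum1_card natr_sum mulr_suml ler_sum // => i _.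
  by rewrite mul1r -real_normK ?num_real // lerXn2r ?nnegrE // entry_norm_le.
rewrite ler_wpM2r ?sqr_ge0 // expr2 -natrM ler_nat.
by case: n => // k; rewrite leq_pmull.
Qed.

(** The infinite value covers an empty [X]. Distances are only nearly attained: a zero set is closed
    relative to the open set, so a nearest point need not exist. *)
Lemma dist_setP X x (rho : R) : 0 < rho -> (forall a, X a -> rho <= `|x - a|) ->
  (dist_set X x = +oo%E) \/ exists d : R, [/\ dist_set X x = d%:E, rho <= d,
     forall a, X a -> d <= eucl (x - a) &
     forall e, d < e -> exists2 a, X a & eucl (x - a) < e].
Proof.
move=> rho0 far.
have lb : (rho%:E <= dist_set X x)%E.
  apply: le_ereal_inf_tmp => _ [a Xa <-]; rewrite lee_fin.
  by apply: le_trans (far a Xa) (norm_le_eucl _).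
case E : (dist_set X x) lb => [d| |] // lb; last by left.
right; exists d; split=> //.
- by move=> a Xa; rewrite -lee_fin -E; apply: ereal_inf_lbound; exists a.
- move=> e de; have : (dist_set X x < e%:E)%E by rewrite E lte_fin.
  by move=> /ereal_inf_lt[_ [a Xa <-]]; rewrite lte_fin => H; exists a.
Qed.

End Distance.

(** * Division by [phi] under the Lojasiewicz condition *)

Section Lojasiewicz.
Context {R : realType} {n : nat} (M : nat -> R).
Hypothesis HM : strongly_regular M.
Local Notation V := 'rV[R]_n.
Local Notation cmb := (cmb M).
Implicit Types (x y a : V) (X O : set V) (f g h phi : V -> R) (s t : seq 'I_n).

Lemma hMbar_dist_ge X x (lam rho : R) : 0 < lam -> 0 < rho ->
  (forall a, X a -> rho <= `|x - a|) ->
  hM M (lam * rho) <= hMbar M (lam%:E * dist_set X x)%E.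
Proof.
move=> lam0 rho0 far; have lr0 : 0 < lam * rho by rewrite mulr_gt0.
have [->|[d [-> rd _ _]]] := dist_setP rho0 far.
  rewrite mulry gtr0_sg // mul1e /= (weight0 HM).
  by apply: hM_le1 => //; apply: ltW.
by rewrite -EFinM /=; apply: hM_homo => //; [exact: ltW|rewrite ler_wpM2l // ltW].
Qed.

Lemma hMbar_dist_gt0 X x (lam rho : R) : 0 < lam -> 0 < rho ->
  (forall a, X a -> rho <= `|x - a|) -> 0 < hMbar M (lam%:E * dist_set X x)%E.
Proof.
move=> lam0 rho0 far; apply: lt_le_trans (hMbar_dist_ge lam0 rho0 far).
by apply: hM_gt0 => //; rewrite mulr_gt0.
Qed.

Lemma hMbar_dist_le1 X x (lam rho : R) : 0 < lam -> 0 < rho ->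
  (forall a, X a -> rho <= `|x - a|) -> hMbar M (lam%:E * dist_set X x)%E <= 1.
Proof.
move=> lam0 rho0 far; have [->|[d [-> rd _ _]]] := dist_setP rho0 far.
  by rewrite mulry gtr0_sg // mul1e /= (weight0 HM).
rewrite -EFinM /=; apply: hM_le1 => //; rewrite mulr_ge0 //; first exact: ltW.
exact: le_trans (ltW rho0) rd.
Qed.

(** The Taylor estimate at [a] holds at every order k with the same constants; the infimum over k is
    what produces [hM]. *)
Lemma flat_estimate O f x0 (r : R) : open O -> inCM M O f ->
  (forall y, `|y - x0| <= r -> O y) ->
  exists C sg c : R, [/\ 0 < C, 0 < sg, 0 < c &
    forall x a, `|x - x0| <= r -> `|a - x0| <= r -> flat_at f a ->
      forall s, `|ipd s f x| <= cmb C sg (size s) * hM M (c * `|x - a|)].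
Proof.
move=> oO fM Or; have sf := inCM_smooth fM.
have [C [sg [C0 s0 Hf]]] := inCM_ball oO fM Or.
have [A A1 HA] := weight_moderate_growth HM; have A0 : 0 < A by lra.
(* The 2 splits the factorial of [k + j], [A] splits the weight, and [n.+1] compares the sum of
   coordinates with the max norm while staying positive for [n = 0]. *)
exists C, (2 * A * sg), (2 * A * sg * n.+1%:R).
have sg2 : 0 < 2 * A * sg by rewrite !mulr_gt0.
have c0 : 0 < 2 * A * sg * n.+1%:R by rewrite mulr_gt0.
split=> // x a xr ar fl s.
have Oa := Or a ar.
have [->|xa] := eqVneq x a.
  rewrite (flat_ipd s oO sf Oa fl) normr0 mulr_ge0 //.
    by apply: (cmb_ge0 HM); apply: ltW.
  by apply: (hM_ge0 HM); rewrite mulr_ge0 // ltW.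
have d0 : 0 < `|x - a| by rewrite normr_gt0 subr_eq0.
set d := `|x - a| in d0 *.
have b0 : 0 < cmb C (2 * A * sg) (size s).
  by rewrite /cmb !mulr_gt0 ?exprn_gt0 ?ltr0n ?fact_gt0 ?(weight_gt0 HM).
rewrite -ler_pdivrMl //; apply: le_hM; first by rewrite mulr_gt0.
move=> k; rewrite ler_pdivrMl //.
have seg (u : R) : 0 <= u <= 1 -> `|u *: (x - a) + a - x0| <= r.
  move=> /andP[u0 u1].
  rewrite (_ : u *: (x - a) + a - x0 = u *: (x - x0) + (1 - u) *: (a - x0)); last first.
    by apply/rowP => i; rewrite !mxE; ring.
  apply: le_trans (ler_normD _ _) _; rewrite !normrZ (ger0_norm u0) ger0_norm ?subr_ge0 //.
  have -> : r = u * r + (1 - u) * r by ring.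
  by rewrite lerD // ler_wpM2l // subr_ge0.
have H1 : 0 <= (1 : R) <= 1 by rewrite ler01 lexx.
have := @flat_taylor _ _ O f a (x - a) (cmb C sg (k + size s)) k s oO sf
  (fun u Hu => Or _ (seg u Hu)) (fun s' => flat_ipd s' oO sf Oa fl) _ 1 H1.
rewrite scale1r subrK expr1n mulr1 => T; apply: le_trans (T _) _.
  by move=> s' u Hu Hs'; rewrite -Hs'; apply: Hf; apply: seg.
set j := size s.
apply: (@le_trans _ _ ((n.+1%:R * d) ^+ k / k`!%:R * cmb C sg (k + j))).
  rewrite ler_wpM2r //; first by apply: (cmb_ge0 HM); apply: ltW.
  rewrite ler_wpM2r ?invr_ge0 // lerXn2r ?nnegrE ?mulr_ge0 ?sumr_ge0 // /d ?normr_ge0 //.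
  apply: le_trans (sum_norm_le _) _.
  by rewrite ler_wpM2r // ler_nat.
have k0 : k`!%:R != 0 :> R by rewrite pnatr_eq0 -lt0n fact_gt0.
have E1 : (k + j)`!%:R <= 2 ^+ (k + j) * (k`!%:R * j`!%:R) :> R.
  rewrite -natrX -!natrM ler_nat.
  rewrite -(@bin_fact (k + j) k) ?leq_addr // addKn leq_mul2r; apply/orP; right.
  rewrite -[2%N]/(1 + 1)%N Pascal (bigD1 (inord k)) //= inordK; last by rewrite ltnS leq_addr.
  by rewrite !exp1n !muln1 leq_addr.
have E2 := HA k j.
have P0 : 0 <= C * sg ^+ (k + j) * (n.+1%:R * d) ^+ k / k`!%:R.
  rewrite !mulr_ge0 ?exprn_ge0 ?invr_ge0 ?mulr_ge0 // ltW //.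
apply: (@le_trans _ _ ((C * sg ^+ (k + j) * (n.+1%:R * d) ^+ k / k`!%:R) *
   (2 ^+ (k + j) * (k`!%:R * j`!%:R) * (A ^+ (k + j) * M k * M j)))).
  rewrite (_ : _ * cmb _ _ _ = (C * sg ^+ (k + j) * (n.+1%:R * d) ^+ k / k`!%:R) *
    ((k + j)`!%:R * M (k + j)%N)); last by rewrite /cmb; ring.
  by rewrite ler_wpM2l // ler_pM // (weight_ge0 HM).
rewrite le_eqVlt; apply/orP; left; apply/eqP.
rewrite /cmb !exprMn !exprD; by field.
Qed.

Section Zeroset.
Variables (O : set V) (phi : V -> R).
Hypotheses (oO : open O) (phiM : inCM M O phi).
Let X := zeroset O phi.
Let U := O `\` X.
Let sphi : smooth O phi := inCM_smooth phiM.

Lemma nonzero_out x : U x -> phi x != 0.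
Proof. by move=> [Ox nX]; apply/eqP => p0; apply: nX. Qed.

Lemma open_nonzero : open U.
Proof.
rewrite openE => x Ux; have [Ox _] := Ux.
have [r r0 Hr] := open_ball_sub oO Ox.
have [cphi _] := iffLR (C1onP _ _) (smooth_C1 [::] sphi) x Ox.
have p0 : 0 < `|phi x| / 2 by rewrite divr_gt0 // normr_gt0 nonzero_out.
have [r' r'0 Hr'] := iffLR (continuous_epsP _ _) cphi _ p0.
apply/near_norm; exists (Num.min r r'); first by rewrite lt_min r0.
move=> y; rewrite lt_min => /andP[yr yr']; split; first exact: Hr.
move=> [_ y0]; have := Hr' y yr'; rewrite /= y0 sub0r normrN.
by move: p0; lra.
Qed.

Lemma far_from_zeroset x : U x -> exists2 rho : R, 0 < rho & forall a, X a -> rho <= `|x - a|.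
Proof.
move=> Ux; have [r r0 Hr] := open_ball_sub open_nonzero Ux.
exists r => // a Xa; rewrite leNgt; apply/negP; rewrite distrC => /Hr[_]; exact.
Qed.

Lemma smooth_inv : smooth U (fun y => (phi y)^-1).
Proof.
apply: smoothV; first exact: open_nonzero; last exact: nonzero_out.
by apply: smooth_sub sphi => x [].
Qed.

Lemma lojasiewicz_ball (lam : R) x0 (r : R) : CM_lojasiewicz M O phi -> 0 < lam ->
  (forall y, `|y - x0| <= r -> O y) ->
  exists C sg : R, [/\ 0 < C, 0 < sg & forall x, `|x - x0| <= r -> ~ X x ->
    forall s, `|ipd s (fun y => (phi y)^-1) x| <=
      cmb C sg (size s) / hMbar M (lam%:E * dist_set X x)%E].
Proof.
move=> loj lam0 Or.
have [C [sg [C0 s0 H]]] := loj _ (compact_closed_ball (r := r) (x0 := x0)) Or lam lam0.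
exists C, sg; split=> // x xr nX s.
have Ux : U x by split=> //; apply: Or.
have := H (fun i => count_mem i s) x xr nX.
by rewrite mdeg_count -(ipd_Dmi s open_nonzero smooth_inv Ux).
Qed.

(** Flatness is assumed only near [x0], so the estimate serves both for dividing a flat function and
    for [f = phi], whose quotient is 1. *)
Lemma lojasiewicz_quotient f x0 (r1 : R) : CM_lojasiewicz M O phi -> inCM M O f ->
  X x0 -> 0 < r1 -> (forall a, X a -> `|a - x0| < r1 -> flat_at f a) ->
  exists2 r : R, 0 < r & exists C sg c : R, [/\ 0 <= C, 0 <= sg, 0 <= c &
    forall x a, O x -> ~ X x -> `|x - x0| < r -> X a -> forall s,
      `|ipd s (fun y => f y * (phi y)^-1) x| <= cmb C sg (size s) * hM M (c * `|x - a|)].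
Proof.
move=> loj fM Xx0 r10 fl; have [Ox0 _] := Xx0.
have [r2 r20 Hr2] := open_ball_sub oO Ox0.
pose r := Num.min r1 r2 / 2.
have m0 : 0 < Num.min r1 r2 by rewrite lt_min r10.
have r0 : 0 < r by rewrite /r; lra.
have rm : r < Num.min r1 r2 by rewrite /r; lra.
have rr1 : r < r1 by apply: lt_le_trans rm _; rewrite ge_min lexx.
have Or y : `|y - x0| <= r -> O y.
  move=> Hy; apply: Hr2; apply: le_lt_trans Hy _; apply: lt_le_trans rm _.
  by rewrite ge_min lexx orbT.
have [C1 [s1 [c1 [C10 s10 c10 H1]]]] := flat_estimate oO fM Or.
have [A A1 HA] := weight_moderate_growth HM; have A0 : 0 < A by lra.
(* A nearly closest zero lies within [2 * d], so [f] is controlled by [hM] at [2 * c1 * d]. With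
   this [lam] the denominator is [hM] at [A] times that argument, and [hM_le_sqr] leaves one factor
   after division. *)
have lam0 : 0 < A * (2 * c1) by rewrite !mulr_gt0.
have [C2 [s2 [C20 s20 H2]]] := lojasiewicz_ball loj lam0 Or.
have N0 : 0 < n.+1%:R :> R by rewrite ltr0n.
(* Keeps the nearly closest zero [b] in the ball of radius [r]: its distance to [x0] is at most
   [1 + 2 * n] times that of [x]. *)
exists (r / (2 * n.+1%:R)); first by rewrite divr_gt0 // mulr_gt0.
exists (C1 * C2), (2 * (s1 + s2)), (A * (2 * c1) * n.+1%:R).
split.
- by rewrite mulr_ge0 // ltW.
- by rewrite mulr_ge0 // addr_ge0 // ltW.
- by rewrite mulr_ge0 // ltW.
move=> x a Ox nX xr Xa s; have Ux : U x by [].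
have [rho rho0 far] := far_from_zeroset Ux.
have xr' : `|x - x0| * (2 * n.+1%:R) < r by rewrite -ltr_pdivlMr // mulr_gt0.
have nat1 : n.+1%:R = n%:R + 1 :> R by rewrite natr1.
have n0 : 0 <= n%:R :> R by [].
have xx0 : 0 <= `|x - x0| by [].
have xnn : 0 <= `|x - x0| * n%:R by rewrite mulr_ge0.
rewrite nat1 in xr'.
have [E|[d [E rd dle dex]]] := dist_setP rho0 far.
  have : (dist_set X x <= (eucl (x - x0))%:E)%E by apply: ereal_inf_lbound; exists x0.
  by rewrite E.
have d0 : 0 < d := lt_le_trans rho0 rd.
have [b Xb db] : exists2 b, X b & eucl (x - b) < 2 * d by apply: dex; lra.
have xb : `|x - b| <= 2 * d := le_trans (norm_le_eucl _) (ltW db).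
have dx0 : d <= n%:R * `|x - x0| := le_trans (dle _ Xx0) (eucl_le_norm _).
have bx0 : `|b - x0| <= r.
  rewrite (_ : b - x0 = (x - x0) - (x - b)); last by apply/rowP => i; rewrite !mxE; ring.
  apply: le_trans (ler_normB _ _) _.
  by move: xr' xb dx0; rewrite [n%:R * _]mulrC !mulrDr; lra.
have xr2 : `|x - x0| <= r by move: xr'; rewrite !mulrDr; lra.
have flb : flat_at f b by apply: fl => //; apply: le_lt_trans bx0 rr1.
set sg := s1 + s2.
have s1s : s1 <= sg by rewrite lerDl ltW.
have s2s : s2 <= sg by rewrite lerDr ltW.
have [C10' C20' s10' s20'] := And4 (ltW C10) (ltW C20) (ltW s10) (ltW s20).
have cd0 : 0 < 2 * c1 * d by rewrite !mulr_gt0.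
have h2 : 0 < hM M (A * (2 * c1) * d) by apply: (hM_gt0 HM); rewrite mulr_gt0.
have h1 : 0 <= hM M (2 * c1 * d) by apply: (hM_ge0 HM); apply: ltW.
have B1 t : `|ipd t f x| <= cmb (C1 * hM M (2 * c1 * d)) sg (size t).
  apply: le_trans (H1 x b xr2 bx0 flb t) _; rewrite mulrC.
  apply: (@le_trans _ _ (hM M (2 * c1 * d) * cmb C1 sg (size t))).
    apply: ler_pM => //.
    - by apply: (hM_ge0 HM); rewrite mulr_ge0 // ltW.
    - exact: (cmb_ge0 HM).
    - apply: (hM_homo HM); first by rewrite mulr_ge0 // ltW.
      by rewrite [2 * _]mulrC -mulrA ler_wpM2l // ltW.
    - exact: cmb_homo.
  by rewrite cmbZ mulrC.
have B2 t : `|ipd t (fun y => (phi y)^-1) x| <= cmb (C2 / hM M (A * (2 * c1) * d)) sg (size t).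
  apply: le_trans (H2 x xr2 nX t) _; rewrite E -EFinM /= mulrC -[C2 / _]mulrC -cmbZ.
  by rewrite ler_wpM2l ?invr_ge0 ?(ltW h2) //; apply: cmb_homo.
have sfU : smooth U f by apply: smooth_sub (inCM_smooth fM) => y [].
have B := @ipdM_cmb _ _ _ HM U f (fun y => (phi y)^-1) _ _ sg x open_nonzero
  sfU smooth_inv Ux _ _ _ B1 B2 s.
apply: le_trans (B _ _ _) _.
- exact: mulr_ge0.
- by rewrite divr_ge0 // ltW.
- exact: addr_ge0.
rewrite [leRHS]mulrC cmbZ; apply: cmb_homo => //.
- by rewrite !mulr_ge0 // invr_ge0 ltW.
- by rewrite mulr_ge0 // addr_ge0.
rewrite (_ : C1 * _ * _ = C1 * C2 * (hM M (2 * c1 * d) / hM M (A * (2 * c1) * d))); last by ring.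
rewrite [leRHS]mulrC ler_wpM2l ?mulr_ge0 //.
apply: (@le_trans _ _ (hM M (A * (2 * c1) * d))).
  rewrite ler_pdivrMr // -expr2 -(mulrA A); exact: (hM_le_sqr HM A1 HA cd0).
apply: (hM_homo HM); first by rewrite mulr_ge0 // ltW.
rewrite -[leRHS]mulrA ler_wpM2l ?(ltW lam0) //.
apply: le_trans (dle a Xa) _; apply: le_trans (eucl_le_norm _) _.
by rewrite ler_wpM2r // ler_nat.
Qed.

Lemma lojasiewicz_division f : CM_lojasiewicz M O phi -> flat_ideal M O X f ->
  exists2 g, flat_ideal M O X g & forall x, O x -> f x = phi x * g x.
Proof.
move=> loj [fM ff]; have sf := inCM_smooth fM.
pose w y := f y * (phi y)^-1.
have sfU : smooth U f by apply: smooth_sub sf => x [].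
have sw : smooth U w by apply: (smoothM open_nonzero sfU smooth_inv).
have est x0 : X x0 -> exists2 r : R, 0 < r & exists C sg c : R, [/\ 0 <= C, 0 <= sg, 0 <= c &
    forall x a, O x -> ~ X x -> `|x - x0| < r -> X a -> forall s,
      `|ipd s w x| <= cmb C sg (size s) * hM M (c * `|x - a|)].
  move=> Xx0; apply: (@lojasiewicz_quotient f x0 1 loj fM Xx0 ltr01).
  by move=> a Xa _; apply: ff.
have [|sg gE] := @smooth_zero_extension _ _ O X w oO open_nonzero sw.
  move=> s a Oa Xa; have [r r0 [C [sg [c [C0 s0 c0 H]]]]] := est a Xa.
  (* The term of index 2 in the infimum supplies the quadratic decay required for gluing. *)
  exists r => //; exists (cmb C sg (size s) * (c ^+ 2 * M 2)).
  move=> x Ox nX xr; apply: le_trans (H x a Ox nX xr Xa s) _.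
  rewrite -mulrA ler_wpM2l //; first exact: (cmb_ge0 HM).
  apply: le_trans (hM_le HM 2 _) _; first exact: mulr_ge0.
  by rewrite exprMn mulrAC.
exists (zero_extension X w); last first.
  move=> x Ox; have [Xx|nX] := pselect (X x).
    rewrite zero_extension_in // mulr0; have := ff x Xx (fun=> 0%N).
    by rewrite DmiE (_ : multi_seq _ = [::]) //; apply: size0nil; rewrite size_multi_seq /mdeg big1.
  by rewrite zero_extension_out // /w mulrCA divff ?mulr1 //; apply: nonzero_out.
split; last first.
  move=> a Xa; apply: ipd_flat => s; have [Oa _] := Xa.
  by rewrite gE // zero_extension_in.
apply: (inCM_local HM sg) => x0 Ox0.
have [Xx0|nX0] := pselect (X x0).
  have [r r0 [C [sg' [c [C0 s0 c0 H]]]]] := est x0 Xx0.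
  exists r => //; exists C, sg'; split=> // x Ox xr s; rewrite gE //.
  have b0 : 0 <= cmb C sg' (size s) by exact: (cmb_ge0 HM).
  have [Xx|nX] := pselect (X x); first by rewrite zero_extension_in ?normr0.
  rewrite zero_extension_out //; apply: le_trans (H x x0 Ox nX xr Xx0 s) _.
  by rewrite ler_piMr // hM_le1 // mulr_ge0.
have Ux0 : U x0 by [].
have [rho rho0 far] := far_from_zeroset Ux0.
have [r2 r20 Hr2] := open_ball_sub open_nonzero Ux0.
pose r := Num.min rho r2 / 2.
have m0 : 0 < Num.min rho r2 by rewrite lt_min rho0.
have r0 : 0 < r by rewrite /r; lra.
have rm : 2 * r = Num.min rho r2 by rewrite /r; lra.
have rrho : 2 * r <= rho by rewrite rm ge_min lexx.
have rr2 : 2 * r <= r2 by rewrite rm ge_min lexx orbT.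
have Ur y : `|y - x0| <= r -> U y by move=> Hy; apply: Hr2; apply: le_lt_trans Hy _; lra.
have Or y : `|y - x0| <= r -> O y by move=> /Ur[].
have [C1 [s1 [C10 s10 H1]]] := inCM_ball oO fM Or.
(* The value [lam = 1] is arbitrary here: on this ball the distance to [X] is at least [r], so the
   denominator is bounded below. *)
have [C2 [s2 [C20 s20 H2]]] := lojasiewicz_ball loj ltr01 Or.
have hr0 : 0 < hM M (1 * r) by apply: (hM_gt0 HM); rewrite mul1r.
exists r => //; exists (C1 * (C2 / hM M (1 * r))), (2 * (s1 + s2)).
have [C10' C20' s10' s20'] := And4 (ltW C10) (ltW C20) (ltW s10) (ltW s20).
have CC : 0 <= C2 / hM M (1 * r) by rewrite divr_ge0 // ltW.
split; [exact: mulr_ge0|by rewrite mulr_ge0 // addr_ge0|].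
move=> x Ox xr s; have Ux := Ur x (ltW xr); have [_ nX] := Ux.
have farx a : X a -> r <= `|x - a|.
  move=> Xa; have := far a Xa; rewrite (_ : x0 - a = (x - a) - (x - x0)); last first.
    by apply/rowP => i; rewrite !mxE; ring.
  by move=> /le_trans/(_ (ler_normB _ _)); move: xr; lra.
rewrite gE // zero_extension_out //.
apply: (ipdM_cmb HM open_nonzero sfU smooth_inv Ux) => //; first exact: addr_ge0.
  by move=> t; apply: le_trans (H1 x (ltW xr) t) _; apply: cmb_homo; rewrite // lerDl.
move=> t; apply: le_trans (H2 x (ltW xr) nX t) _.
rewrite mulrC -[C2 / _]mulrC -cmbZ; apply: ler_pM; rewrite ?invr_ge0.
- by apply: ltW; apply: hMbar_dist_gt0 ltr01 r0 farx.
- exact: (cmb_ge0 HM).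
- rewrite lef_pV2 ?posrE //; first exact: hMbar_dist_ge ltr01 r0 farx.
  exact: hMbar_dist_gt0 ltr01 r0 farx.
- by apply: cmb_homo; rewrite // lerDr.
Qed.

(** If all zeros near [a] were flat, the quotient estimate with [f = phi] would bound 1 by a
    multiple of [|x - a|^2] at every nearby non-zero [x]; there would be none close to [a], making
    [a] interior. *)
Lemma lojasiewicz_nonflat_dense a : CM_lojasiewicz M O phi ->
  X a -> ~ interior X a -> closure (X `\` [set b | X b /\ flat_at phi b]) a.
Proof.
move=> loj Xa nint; apply: contrapT => /existsNP[B /not_implyP[/near_norm[r1 r10 HB] nB]].
have fl b : X b -> `|b - a| < r1 -> flat_at phi b.
  move=> Xb br; apply: contrapT => nfl; apply: nB; exists b; split; last exact: HB.
  by split=> // -[].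
have [r r0 [C [sg [c [C0 s0 c0 H]]]]] := lojasiewicz_quotient loj phiM Xa r10 fl.
have [Oa _] := Xa; have [r2 r20 Hr2] := open_ball_sub oO Oa.
pose D := C * (c ^+ 2 * M 2) + 1.
have D0 : 0 < D.
  by rewrite ltr_wpDl // !mulr_ge0 ?exprn_ge0 // (weight_ge0 HM).
apply: nint; apply/near_norm.
exists (Num.min (Num.min r r2) (Num.min 1 D^-1)).
  by rewrite !lt_min r0 r20 ltr01 invr_gt0.
move=> x; rewrite !lt_min => /andP[/andP[xr xr2] /andP[x1 xD]].
apply: contrapT => nX; have Ox := Hr2 x xr2.
have := H x a Ox nX xr Xa [::]; rewrite /= mulfV; last by apply: nonzero_out.
rewrite normr1 /cmb expr0 fact0 (weight0 HM) !mulr1 leNgt => /negP; apply.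
have h2 := hM_le HM 2 (mulr_ge0 c0 (normr_ge0 (x - a))).
apply: (@le_lt_trans _ _ (C * ((c * `|x - a|) ^+ 2 * M 2))); first exact: ler_wpM2l.
rewrite (_ : C * _ = C * (c ^+ 2 * M 2) * `|x - a| ^+ 2); last by rewrite exprMn; ring.
have [->|xa] := eqVneq `|x - a| 0; first by rewrite expr0n /= mulr0 ltr01.
have xa0 : 0 < `|x - a| by rewrite lt_def xa normr_ge0.
apply: (@lt_le_trans _ _ (D * `|x - a| ^+ 2)).
  by rewrite ltr_pM2r ?exprn_gt0 // ltrDl.
apply: (@le_trans _ _ (D * `|x - a|)).
  by rewrite ler_pM2l // expr2 ler_piMl // ltW.
by rewrite -ler_pdivlMl // mulr1 ltW.
Qed.

Lemma flat_mul f g : inCM M O f -> flat_ideal M O X g ->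
  (forall x, O x -> f x = phi x * g x) -> flat_ideal M O X f.
Proof.
move=> fM [gM gf] E; split=> // a Xa; have [Oa _] := Xa.
apply: ipd_flat => s; rewrite (eq_on_iter s oO E Oa).
(* A ball of radius 0: bounds for [phi] are wanted only at the point [a], where every Leibniz term
   has a vanishing derivative of [g]. *)
have O0 y : `|y - a| <= 0 -> O y.
  by rewrite normr_le0 subr_eq0 => /eqP->.
have [C [sg [C0 s0 H]]] := inCM_ball oO phiM O0.
apply/eqP; rewrite -normr_le0.
apply: le_trans (ipdM_le (F := cmb C sg) (G := fun=> 0) s oO sphi (inCM_smooth gM) Oa _ _) _.
- by move=> t; apply: H; rewrite subrr normr0.
- by move=> t; rewrite (flat_ipd t oO (inCM_smooth gM) Oa (gf a Xa)) normr0.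
by rewrite big1 // => k _; rewrite !mulr0.
Qed.

End Zeroset.
End Lojasiewicz.

(** * From divisibility to the Lojasiewicz condition *)

Section DivisionImpliesLojasiewicz.
Context {R : realType} {n : nat} (M : nat -> R).
Hypothesis HM : strongly_regular M.
Local Notation V := 'rV[R]_n.
Local Notation cmb := (cmb M).
Implicit Types (x y a : V) (f g h : V -> R) (s t : seq 'I_n).

Lemma ipd_locally_cst f (c : R) x (r : R) s : 0 < r ->
  (forall y, `|y - x| < r -> f y = c) -> ipd s f x = if s is [::] then c else 0.
Proof.
move=> r0 fc.
have fc' y : ball x r y -> f y = c by move=> /ball_normE; apply: fc.
rewrite (eq_on_iter s (ball_open x r) fc' (ballxx x r0)).
by case: s => // i s; apply: ipd_cst.
Qed.

Variables (O : set V) (phi : V -> R).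
Hypotheses (oO : open O) (phiM : inCM M O phi).
Let X := zeroset O phi.
Let U := O `\` X.
Hypothesis flatI : flat_ideal M O X `<=` princ_ideal M O phi.

Let loj_at (lam c : R) x := O x -> ~ X x -> forall s,
  `|ipd s (fun y => (phi y)^-1) x| <= cmb c c (size s) / hMbar M (lam%:E * dist_set X x)%E.

(** A bump at [x0] supported off [X] is flat on [X], and its quotient by [phi] is 1/phi near [x0];
    so 1/phi satisfies class bounds there, and dividing by a value of [hMbar] at most 1 only weakens
    them. *)
Lemma division_local_out (lam : R) x0 : 0 < lam -> U x0 ->
  exists2 r : R, 0 < r & exists2 c : R, 0 <= c & forall x, `|x - x0| < r -> loj_at lam c x.
Proof.
move=> lam0 Ux0.
have oU := open_nonzero oO phiM : open U.
have [rho rho0 Hrho] := open_ball_sub oU Ux0.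
pose r := rho / 2.
have r0 : 0 < r by rewrite /r; lra.
have rE : rho = 2 * r by rewrite /r; lra.
have [sg sg0 Hsg] := @adapted_bump R n M HM 1 ltr01.
have [chi [schi chi0 chi1 chiB]] := Hsg r x0 r0.
have hr0 : 0 < hM M (1 * r) by apply: (hM_gt0 HM); rewrite mul1r.
have schiO : smooth O chi by apply: smooth_sub schi.
have chiM : inCM M O chi.
  apply: (inCM_bounded HM (C := (hM M (1 * r))^-1) (sg := sg) oO schiO).
  - by rewrite invr_ge0 ltW.
  - exact: ltW.
  - move=> x s _; rewrite -[_^-1]mulr1 -cmbZ ler_pdivlMl //; exact: chiB.
have chif : flat_ideal M O X chi.
  split=> // a Xa; apply: ipd_flat => s.
  have ar : rho <= `|a - x0| by rewrite leNgt; apply/negP => /Hrho[_]; apply.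
  rewrite (@ipd_locally_cst chi 0 a r) //; first by case: s.
  move=> y ya; apply: chi0; move: ar.
  rewrite (_ : a - x0 = (y - x0) - (y - a)); last by apply/rowP => i; rewrite !mxE; ring.
  by move=> /le_trans/(_ (ler_normB _ _)); lra.
have [_ [h hCM hE]] := flatI chif.
have [r2 r20 Hr2] := open_ball_sub oO (Ux0.1).
pose r3 := Num.min r r2 / 2.
have m0 : 0 < Num.min r r2 by rewrite lt_min r0.
have r30 : 0 < r3 by rewrite /r3; lra.
have m3 : Num.min r r2 = 2 * r3 by rewrite /r3; lra.
have r3r : 2 * r3 <= r by rewrite -m3 ge_min lexx.
have r3r2 : 2 * r3 <= r2 by rewrite -m3 ge_min lexx orbT.
have O3 y : `|y - x0| <= r3 -> O y by move=> Hy; apply: Hr2; apply: le_lt_trans Hy _; lra.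
have [C [sg' [C0 s0 H]]] := inCM_ball oO hCM O3.
exists r3 => //; exists (C + sg'); first by rewrite addr_ge0 // ltW.
move=> x xr Ox nX s.
have E : forall y, ball x0 r3 y -> (phi y)^-1 = h y.
  move=> y /ball_normE yr; have Uy : U y by apply: Hrho; lra.
  have := hE y Uy.1; rewrite chi1; last by lra.
  by have p0 := nonzero_out Uy; move=> E; apply: (mulfI p0); rewrite -E mulfV.
rewrite (eq_on_iter s (ball_open x0 r3) E); last exact/ball_normE.
have Ux : U x by [].
have [rho' rho'0 far] := far_from_zeroset oO phiM Ux.
have h1 := hMbar_dist_le1 HM lam0 rho'0 far.
have h0 := hMbar_dist_gt0 HM lam0 rho'0 far.
rewrite ler_pdivlMr //; apply: (@le_trans _ _ (`|ipd s h x| * 1)).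
  by rewrite ler_wpM2l.
rewrite mulr1; apply: le_trans (H x (ltW xr) s) _.
by apply: cmb_homo; rewrite // ?lerDl ?lerDr ltW.
Qed.

Lemma division_local_in (lam : R) x0 : 0 < lam -> X x0 ->
  exists2 r : R, 0 < r & exists2 c : R, 0 <= c & forall x, `|x - x0| < r -> loj_at lam c x.
Proof.
move=> lam0 Xx0; have [Ox0 _] := Xx0.
have oU := open_nonzero oO phiM : open U.
apply: contrapT => none.
have bad (r c : R) : 0 < r -> 0 <= c -> exists xs : V * seq 'I_n,
   [/\ `|xs.1 - x0| < r, U xs.1 & cmb c c (size xs.2) / hMbar M (lam%:E * dist_set X xs.1)%E <
     `|ipd xs.2 (fun y => (phi y)^-1) xs.1| ].
  move=> r0 c0; apply: contrapT => H; apply: none.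
  exists r => //; exists c => // x xr Ox nX s; rewrite leNgt; apply/negP => B.
  by apply: H; exists (x, s).
have [R1 R10 HR1] := open_ball_sub oO Ox0.
pose R0 := R1 / 2.
have R00 : 0 < R0 by rewrite /R0; lra.
have OR0 y : `|y - x0| <= R0 -> O y.
  by move=> Hy; apply: HR1; apply: le_lt_trans Hy _; rewrite /R0; lra.
(* Inadmissible pairs receive a dummy value, so that the recursion defining [rho] can call a total
   function. *)
have [F HF] : exists F : R * R -> V * seq 'I_n, forall rc, 0 < rc.1 -> 0 <= rc.2 ->
   [/\ `|(F rc).1 - x0| < rc.1, U (F rc).1 &
     cmb rc.2 rc.2 (size (F rc).2) / hMbar M (lam%:E * dist_set X (F rc).1)%E <
     `|ipd (F rc).2 (fun y => (phi y)^-1) (F rc).1| ].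
  have /choice[F HF] : forall rc : R * R, exists xs : V * seq 'I_n, 0 < rc.1 -> 0 <= rc.2 ->
   [/\ `|xs.1 - x0| < rc.1, U xs.1 &
     cmb rc.2 rc.2 (size xs.2) / hMbar M (lam%:E * dist_set X xs.1)%E <
     `|ipd xs.2 (fun y => (phi y)^-1) xs.1| ].
    move=> [r c] /=; have [[r0 c0]|H] := pselect (0 < r /\ 0 <= c).
      by have [xs Hxs] := bad r c r0 c0; exists xs.
    by exists (x0, [::]) => r0 c0; case: H.
  by exists F.
pose N : R := n.+1%:R.
have N0 : 0 < N by rewrite ltr0n.
pose delta x : R := fine (dist_set X x).
have deltaP x : U x -> [/\ 0 < delta x, dist_set X x = (delta x)%:E &
    forall a, X a -> 2 * (delta x / (2 * N)) <= `|x - a| ].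
  move=> Ux; have [rho rho0 far] := far_from_zeroset oO phiM Ux.
  have [E|[d [E rd dle _]]] := dist_setP rho0 far.
    have : (dist_set X x <= (eucl (x - x0))%:E)%E by apply: ereal_inf_lbound; exists x0.
    by rewrite E.
  rewrite /delta E /=; split=> //; first exact: lt_le_trans rd.
  move=> a Xa; rewrite (_ : 2 * _ = d / N); last by field; rewrite gt_eqF.
  rewrite ler_pdivrMr //; apply: le_trans (dle a Xa) _; apply: le_trans (eucl_le_norm _) _.
  by rewrite mulrC ler_wpM2l // ler_nat.
(* The power of two cancels the dyadic weight of the [p]-th bump; the remaining [p.+1] must outgrow
   the constants of the quotient. *)
pose cc (p : nat) : R := 2 ^+ p.+1 * p.+1%:R.
have cc0 p : 0 <= cc p by rewrite mulr_ge0 // exprn_ge0.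
(* The divisor [2 * N] keeps [X] at max-norm distance at least [2 * rho p.+1] from the [p]-th point,
   since the Euclidean norm is at most [N] times the max norm. *)
pose fix rho (p : nat) : R :=
  if p is q.+1 then delta (F (rho q, cc q)).1 / (2 * N) else R0.
pose xp p := (F (rho p, cc p)).1; pose sp p := (F (rho p, cc p)).2.
have rhoS p : rho p.+1 = delta (xp p) / (2 * N) by [].
have rho0 p : 0 < rho p.
  elim: p => // p IH; rewrite rhoS; have [_ Ux _] := HF (rho p, cc p) IH (cc0 p).
  by have [d0 _ _] := deltaP _ Ux; rewrite divr_gt0 // mulr_gt0.
have xpU p : U (xp p) by have [] := HF (rho p, cc p) (rho0 p) (cc0 p).
have xp_lt p : `|xp p - x0| < rho p by have [] := HF (rho p, cc p) (rho0 p) (cc0 p).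
have xp_far p a : X a -> 2 * rho p.+1 <= `|xp p - a|.
  by have [_ _] := deltaP _ (xpU p); apply.
have rho_dec p q : (p <= q)%N -> rho q <= rho p.
  move=> /subnK <-; elim: (q - p)%N => // k IH; apply: le_trans IH.
  by rewrite addSn; have := xp_far (k + p)%N x0 Xx0; have := xp_lt (k + p)%N; have := rho0 (k + p).+1; lra.
have sep p q : p != q -> rho q.+1 < `|xp p - xp q|.
  rewrite neq_ltn => /orP[pq|qp].
    have h1 := xp_far p x0 Xx0; have h2 := xp_lt q; have h3 := rho_dec _ _ pq.
    have h4 := xp_far q x0 Xx0.
    have : `|xp p - x0| <= `|xp p - xp q| + `|xp q - x0|.
      by apply: le_trans (ler_normD _ _); rewrite addrA subrK.
    have := rho0 q.+1; lra.
  have h1 := xp_far q x0 Xx0; have h2 := xp_lt p; have h3 := rho_dec _ _ qp.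
  have : `|xp q - x0| <= `|xp p - xp q| + `|xp p - x0|.
    by rewrite (distrC (xp p) (xp q)); apply: le_trans (ler_normD _ _); rewrite addrA subrK.
  lra.
(* [rho p.+1] serves both as radius of the bump at [xp p] and as bound for the
   distance of the later points to [x0]; this keeps each [xp p] out of the
   supports of the other bumps. *)
pose lamb := lam * (2 * N).
have lamb0 : 0 < lamb by rewrite !mulr_gt0.
have [sg sg0 Hsg] := @adapted_bump R n M HM lamb lamb0.
have /choice[chi Hchi] : forall p, exists chi : V -> R, [/\ smooth setT chi,
      forall y, rho p.+1 <= `|y - xp p| -> chi y = 0,
      forall y, `|y - xp p| <= rho p.+1 / 2 -> chi y = 1 &
      forall s y, hM M (lamb * rho p.+1) * `|ipd s chi y| <= cmb 1 sg (size s)].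
  by move=> p; apply: Hsg.
have hE p : hMbar M (lam%:E * dist_set X (xp p))%E = hM M (lamb * rho p.+1).
  have [_ -> _] := deltaP _ (xpU p); rewrite -EFinM /=; congr (hM M _).
  by rewrite ?rhoS -?/(xp p) /lamb; field; rewrite gt_eqF.
pose H p := hM M (lamb * rho p.+1).
have H0 p : 0 < H p by apply: (hM_gt0 HM); rewrite mulr_gt0.
pose f p y := H p * chi p y.
have schi p : smooth setT (chi p) by have [] := Hchi p.
have sf p : smooth setT (f p).
  by apply: smoothM => //; [exact: openT|apply: smooth_cst; exact: openT].
have fE p s x : ipd s (f p) x = H p * ipd s (chi p) x.
  exact: (ipdZ _ s openT (schi p) (Logic.I : setT x)).
have fB p s x : `|ipd s (f p) x| <= cmb 1 sg (size s).
  by rewrite fE normrM (gtr0_norm (H0 p)); have [_ _ _] := Hchi p; apply.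
have f_out p s x : rho p.+1 < `|x - xp p| -> ipd s (f p) x = 0.
  move=> Hx; have Hr : 0 < `|x - xp p| - rho p.+1 by rewrite subr_gt0.
  rewrite fE (@ipd_locally_cst (chi p) 0 x _ s Hr); first by case: s => [|? ?]; rewrite mulr0.
  move=> y yx; have [_ c0 _ _] := Hchi p; apply: c0.
  have : `|x - xp p| <= `|y - x| + `|y - xp p|.
    by rewrite (distrC y x); apply: le_trans (ler_normD _ _); rewrite addrA subrK.
  by lra.
have f_in p s : ipd s (f p) (xp p) = if s is [::] then H p else 0.
  have Hr : 0 < rho p.+1 / 2 by have := rho0 p.+1; lra.
  apply: (@ipd_locally_cst (f p) (H p) _ _ s Hr).
  by move=> y yx; have [_ _ c1 _] := Hchi p; rewrite /f c1 ?mulr1 // ltW.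
have [sG GE] := smooth_dyadic_sum sf fB.
set G := (fun x => dyadic_sum (fun p => f p x)) in sG GE.
have sGO : smooth O G by apply: smooth_sub sG.
have GM : inCM M O G.
  apply: (inCM_bounded HM (C := 1) (sg := sg) oO sGO) => //; first exact: ltW.
  by move=> x s _; rewrite GE; apply: dyadic_sum_le.
have Gf : flat_ideal M O X G.
  split=> // a Xa; apply: ipd_flat => s.
  (* All terms vanish at [a]; the index 0 singled out here is arbitrary and its term vanishes
     too. *)
  rewrite GE (@dyadic_sum_single _ _ 0%N); last first.
    by move=> p _; apply: f_out; rewrite distrC; have := xp_far p a Xa; have := rho0 p.+1; lra.
  by rewrite f_out ?mulr0 // distrC; have := xp_far 0%N a Xa; have := rho0 1%N; lra.
have [_ [h hM' hG]] := flatI Gf.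
have [C [sg' [C0 s0 HC]]] := inCM_ball oO hM' OR0.
have [p pC] : exists p : nat, C + sg' <= p.+1%:R.
  exists (Num.trunc (C + sg')); apply: ltW; apply: truncnS_gt.
pose w := (2^-1 : R) ^+ p.+1 * H p.
have w0 : 0 < w by rewrite mulr_gt0 // exprn_gt0.
have Gx s : ipd s G (xp p) = if s is [::] then w else 0.
  rewrite GE (@dyadic_sum_single _ _ p).
    by rewrite f_in; case: s => // *; rewrite mulr0.
  by move=> q qp; apply: f_out; apply: sep; rewrite eq_sym.
have sinv := smooth_inv oO phiM.
(* All derivatives of [G - w] vanish at [xp p], so the second summand contributes nothing to the jet
   of [h] there. *)
have hU y : U y -> h y = w * (phi y)^-1 + (G y + - w) * (phi y)^-1.
  move=> Uy; rewrite -mulrDl addrC subrK hG; last by case: Uy.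
  by rewrite mulrC mulrA mulVf ?mul1r //; apply: nonzero_out Uy.
have sGU : smooth U (fun y => G y + - w).
  apply: smoothD => //; first by apply: smooth_sub sG.
  exact: smooth_cst.
have swU : smooth U (fun y => w * (phi y)^-1) by apply: smoothM => //; exact: smooth_cst.
pose s := sp p.
have jet : ipd s h (xp p) = w * ipd s (fun y => (phi y)^-1) (xp p).
  rewrite (eq_on_iter s oU hU (xpU p)).
  rewrite (ipdD _ oU swU (smoothM oU sGU sinv) (xpU p)) (ipdZ _ s oU sinv (xpU p)).
  rewrite [X in _ + X](_ : _ = 0) ?addr0 //; apply/eqP; rewrite -normr_le0.
  have Gw t : ipd t (fun y => G y + - w) (xp p) = 0.
    rewrite (ipdD t openT sG (smooth_cst _ openT) (Logic.I : setT (xp p))) Gx.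
    by case: t => [|i t]; [rewrite /= subrr|rewrite ipd_cst // addr0].
  (* Any bound for 1/phi depending only on the length of the word will do, as it gets multiplied by
     0; the sum over all words of that length is one. *)
  apply: le_trans (ipdM_le (F := fun=> 0) (G := fun k => \sum_(t : k.-tuple 'I_n)
      `|ipd t (fun y => (phi y)^-1) (xp p)|) s oU sGU sinv (xpU p) _ _) _.
  - by move=> t; rewrite Gw normr0.
  - by move=> t; rewrite (bigD1 (in_tuple t)) //= lerDl sumr_ge0.
  - by rewrite big1 // => k _; rewrite mul0r mulr0.
have [_ _ viol] := HF (rho p, cc p) (rho0 p) (cc0 p).
have xpR : `|xp p - x0| <= R0 by apply: ltW; apply: lt_le_trans (xp_lt p) (rho_dec 0%N p _).
have := HC _ xpR s; rewrite jet normrM (gtr0_norm w0) leNgt => /negP; apply.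
move: viol; rewrite /= -/(xp p) -/(sp p) -/s hE -/(H p) ltr_pdivrMr // => viol.
apply: (@le_lt_trans _ _ ((2^-1 : R) ^+ p.+1 * cmb (cc p) (cc p) (size s))).
  rewrite cmbZ /cc mulrA -exprMn mulVf // expr1n mul1r.
  apply: cmb_homo => //; rewrite ?(ltW C0) ?(ltW s0) //.
    by apply: le_trans pC; rewrite lerDl ltW.
  apply: (@le_trans _ _ p.+1%:R); first by apply: le_trans pC; rewrite lerDr ltW.
  by rewrite ler_peMl // exprn_ege1 // ler1n.
by rewrite /w -mulrA ltr_pM2l ?exprn_gt0 // mulrC.
Qed.

Lemma division_lojasiewicz : CM_lojasiewicz M O phi.
Proof.
move=> K cK KO lam lam0; rewrite -/X.
pose P (c : R) x := 0 <= c /\ loj_at lam c x.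
have [||c c0 Hc] := @compact_uniform_bound R n K P cK.
- move=> c c' x cc [c0 H]; split; first exact: le_trans cc.
  move=> Ox nX s; apply: le_trans (H Ox nX s) _.
  have [rho rho0 far] := far_from_zeroset oO phiM (conj Ox nX : U x).
  rewrite ler_wpM2r //; last exact: cmb_homo.
  by rewrite invr_ge0 ltW // (hMbar_dist_gt0 HM lam0 rho0 far).
- move=> x0 Kx0; have [Xx0|nX0] := pselect (X x0).
    have [r r0 [c c0 H]] := division_local_in lam0 Xx0.
    by exists r => //; exists c => x xr; split=> //; apply: H.
  have [r r0 [c c0 H]] := division_local_out lam0 (conj (KO _ Kx0) nX0 : U x0).
  by exists r => //; exists c => x xr; split=> //; apply: H.
exists c, c; split=> // J x Kx nX; rewrite DmiE -size_multi_seq.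
by have [_] := Hc x Kx; apply => //; apply: KO.
Qed.

End DivisionImpliesLojasiewicz.

Theorem theorem3p4 (R : realType) (n : nat) (M : nat -> R)
    (O : set 'rV[R]_n) (phi : 'rV[R]_n -> R) :
  strongly_regular M -> open O -> inCM M O phi ->
  (exists x, O x /\ phi x != 0) ->
  let X := zeroset O phi in
  let Xinf := [set a | X a /\ flat_at phi a] in
  (CM_lojasiewicz M O phi <->
     (flat_ideal M O X `<=` princ_ideal M O phi /\
      (forall a, X a -> ~ interior X a -> closure (X `\` Xinf) a))) /\
  (CM_lojasiewicz M O phi <-> flat_ideal M O X = prod_ideal M O phi X).
Proof.
move=> HM oO phiM _ X Xinf.
have back : flat_ideal M O X `<=` princ_ideal M O phi -> CM_lojasiewicz M O phi.
  exact: division_lojasiewicz.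
split; split.
- move=> loj; split; last by move=> a; apply: (lojasiewicz_nonflat_dense HM oO phiM loj).
  move=> f fX; have [g [gM _] fg] := lojasiewicz_division HM oO phiM loj fX.
  by split; [exact: fX.1|exists g].
- by move=> [/back].
- move=> loj; apply/seteqP; split=> f.
    move=> fX; have [g gX fg] := lojasiewicz_division HM oO phiM loj fX.
    by split; [exact: fX.1|exists g].
  by move=> [fM [g gX fg]]; apply: (flat_mul oO phiM fM gX fg).
- move=> E; apply: back => f; rewrite E => -[fM [g [gM _] fg]].
  by split=> //; exists g.
Qed.
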